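(* Let $X$ be a smooth connected variety over $\mathbb{C}$, $L$ a line bundle on $X$, and $X_2$ the trivial primitive double scheme with support $X$ and associated line bundle $L$. Consider the action of $\mathrm{Aut}(X_2)$ on $H^1(X,(\Omega_{X_2|X})^*\otimes L^2)\simeq H^1(X,L)\times H^1(X,T_X\otimes L^2)$ whose orbits parametrize the extensions of $X_2$ to primitive multiple schemes of multiplicity $3$. Let $(\eta,\epsilon)\in H^1(X,L)\times H^1(X,T_X\otimes L^2)$, let $\chi\in\mathrm{Aut}_0(X_2)\simeq H^0(X,T_X\otimes L)$, and let $(\eta',\epsilon')=\chi\cdot(\eta,\epsilon)$. Then $$\eta'=\eta+\langle\chi,\nabla_0(L)\rangle,\qquad\epsilon'=\epsilon-\eta\chi-\frac{1}{2}\langle\chi,\nabla_0(L)\rangle\chi .$$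
   Context: Schemes. The trivial primitive double scheme $X_2$ is the second infinitesimal neighbourhood (defined by the square of the ideal) of the zero section $X$ in the total space of $L^*$. $\mathrm{Aut}(X_2)$ is the group of automorphisms of $X_2$ inducing the identity on $X$, and $\mathrm{Aut}_0(X_2)$ the subgroup of those inducing the identity on $L=\mathcal{I}_X/\mathcal{I}_X^2$. $\mathrm{Aut}_0(X_2)\simeq H^0(X,T_X\otimes L)$: $\chi$ corresponds to the derivation $D$ with values in $\mathcal{I}_X=L$ such that $\chi^*(f)=f+D(f)$. A primitive multiple scheme of multiplicity $n$ with support $X$ is a Cohen-Macaulay scheme with reduced subscheme $X$, locally embeddable in smooth varieties of dimension $\dim(X)+1$, $n$ being the smallest integer with $\mathcal{I}_X^n=0$; it is locally isomorphic to $U\times\mathrm{Spec}(\mathbb{C}[t]/(t^n))$. Group sheaf. For an open $U\subset X$, $\mathcal{G}_n(U)$ is the group of automorphisms of the $\mathbb{C}$-algebra $\mathcal{O}_X(U)[t]/(t^n)$ inducing the identity on the quotient by $(t)$; $H^1(X,\mathcal{G}_n)$ is the set of isomorphism classes of primitive multiple schemes of multiplicity $n$ with support $X$. Let $(\nu_{ij})$ be a cocycle defining $L$ for an open cover $(U_i)$ and trivializations of $L$ on the $U_i$. The trivial scheme of multiplicity $3$ is given by the cocycle $(g_{ij})$ of $\mathcal{G}_3$, $g_{ij}:f\mapsto f$ (for $f\in\mathcal{O}_X(U_{ij})$), $t\mapsto\nu_{ij}t$. Cohomology classes. Throughout, a cocycle of $T_X^{\otimes a}\otimes L^b$ ($a\in\{0,1\}$)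 is described by sections $(s_{ij})$ of $T_X^{\otimes a}$ on the $U_{ij}$ with $s_{ik}=s_{ij}+\nu_{ij}^b s_{jk}$, $s_{ij}$ being viewed as a section of $T_X^{\otimes a}\otimes L^b$ by means of the trivialization of $L$ on $U_i$. Let $\eta\in H^1(X,L)$ and $\epsilon\in H^1(X,T_X\otimes L^2)$ be represented in this way by $(\eta_{ij})$ and $(\epsilon_{ij})$; since $X_2$ is trivial, $(\Omega_{X_2|X})^*\simeq L^{-1}\oplus T_X$. To $\gamma=(\eta,\epsilon)$ one associates $\gamma_{ij}\in\ker(\mathcal{G}_3\to\mathcal{G}_2)(U_{ij})$, $\gamma_{ij}:f\mapsto f+\epsilon_{ij}(f)t^2$, $t\mapsto(1+\eta_{ij}t)t$; then $(\gamma_{ij}g_{ij})$ is a cocycle of $\mathcal{G}_3$ defining an extension of $X_2$ to multiplicity $3$, and every extension is obtained in this way. Action. Let $\chi\in\mathrm{Aut}(X_2)$ be given locally by $\chi_i\in\mathcal{G}_2(U_i)$ (the expression of $\chi^*$ in the trivialization over $U_i$), and let $c_i\in\mathcal{G}_3(U_i)$ be a lift of $\chi_i$. Then $\chi\cdot\gamma$ is the class defined by $\theta_{ij}=c_i\gamma_{ij}g_{ij}c_j^{-1}g_{ij}^{-1}$. Two elements define isomorphic extensions if and only if they are in the same orbit of $\mathrm{Aut}(X_2)$. Products. $\nabla_0(L)\in H^1(X,\Omega_X)$ is the class of the cocycle $(d\nu_{ij}/\nu_{ij})$. $\langle\cdot,\cdot\rangle:H^0(X,T_X\otimes L)\times H^1(X,\Omega_X)\to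 H^1(X,L)$ is induced by the duality between $T_X$ and $\Omega_X$, and $H^1(X,L)\times H^0(X,T_X\otimes L)\to H^1(X,T_X\otimes L^2)$, $(\eta,\chi)\mapsto\eta\chi$, is the canonical product. *)

(* Defs.v *)
From HB Require Import structures.
From mathcomp Require Import all_boot all_order all_algebra.
From mathcomp Require Import generic_quotient ring_quotient qpoly.
From mathcomp Require mpoly.
From mathcomp Require Import ring.
From mathcomp Require Import all_classical reals topology complex.
Set Implicit Arguments. Unset Strict Implicit. Unset Printing Implicit Defensive.
Import GRing.Theory Num.Theory.
Local Open Scope classical_set_scope.
Local Open Scope ring_scope.
Local Open Scope quotient_scope.

(* A variety is a space with functions in the sense of Serre: a topological
   space (the closed points with the Zariski topology) together with a sheaf
   of algebras of complex valued functions.  A section over U is encoded by a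
   function on the whole space of which only the values on U matter. *)
Record fspace (R : realType) := FSpace {
  fcar :> topologicalType;
  reg : set fcar -> set (fcar -> R[i]);
  reg_ext : forall U f g, {in U, f =1 g} -> reg U f -> reg U g;
  reg_sub : forall U V f, open U -> open V -> V `<=` U -> reg U f -> reg V f;
  reg_glue : forall U f, open U ->
    (forall x, U x -> exists V, [/\ open V, V x, V `<=` U & reg V f]) ->
    reg U f;
  reg_cst : forall U (a : R[i]), open U -> reg U (fun=> a);
  reg_add : forall U f g, open U -> reg U f -> reg U g -> reg U (f \+ g);
  reg_mul : forall U f g, open U -> reg U f -> reg U g -> reg U (f \* g)
}.

Section Varieties.
Variables (R : realType) (X : fspace R).
Local Notation C := R[i].

Definition peval n (p : mpoly.mpoly n C) (a : 'rV[C]_n) : C :=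
  mpoly.meval (fun i => a 0 i) p.

Definition zeros n (S : set (mpoly.mpoly n C)) : set 'rV[C]_n :=
  [set a | forall p, S p -> peval p a = 0].

(* An isomorphism of the open subspace ch_dom with the closed subvariety of
   affine space defined by the equations ch_eqs, where the Jacobian matrix has
   everywhere rank equal to the number of equations; so these generate the
   ideal of the subvariety, which is smooth. *)
Record smooth_chart := SmoothChart {
  ch_dom : set X;
  ch_dim : nat;
  ch_neq : nat;
  ch_eqs : 'I_ch_neq -> mpoly.mpoly ch_dim C;
  ch_map : X -> 'rV[C]_ch_dim;
  ch_open : open ch_dom;
  ch_inj : {in ch_dom &, injective ch_map};
  ch_image : ch_map @` ch_dom = zeros (range ch_eqs);
  ch_topology : forall V, V `<=` ch_dom ->
    (open V <-> exists S, V = ch_dom `\` ch_map @^-1` zeros S);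
  ch_regular : forall V f, open V -> V `<=` ch_dom ->
    (reg V f <-> forall x, V x -> exists p q W,
       [/\ open W, W x, W `<=` V & forall y, W y ->
         peval q (ch_map y) != 0 /\
         f y = peval p (ch_map y) / peval q (ch_map y)]);
  ch_jacobian : forall x, ch_dom x ->
    \rank (\matrix_(i < ch_neq, j < ch_dim)
             peval (mpoly.mderiv j (ch_eqs i)) (ch_map x)) = ch_neq
}.

(* Finitely many charts; the last condition is Serre's axiom of separation. *)
Definition smooth_variety : Prop :=
  exists (k : nat) (ch : 'I_k -> smooth_chart),
    (forall x : X, exists i, ch_dom (ch i) x) /\
    (forall i j, exists S : set (mpoly.mpoly (ch_dim (ch i) + ch_dim (ch j)) C),
       (fun x => row_mx (ch_map (ch i) x) (ch_map (ch j) x))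
         @` (ch_dom (ch i) `&` ch_dom (ch j)) = zeros S).

Definition smooth_connected_variety : Prop :=
  [/\ smooth_variety, [set: X] !=set0 & connected [set: X]].

(* e is a basis of the O_U-module F|_U, F being a sheaf of submodules of the
   sheaf of all functions. *)
Definition is_frame (F : set X -> set (X -> C)) (U : set X) (e : X -> C) :=
  (forall x, U x -> e x != 0) /\
  forall V s, open V -> V `<=` U -> (F V s <-> reg V (fun x => s x / e x)).

End Varieties.

(* A line bundle, through its sheaf of sections.  A basis of each fibre is
   chosen, independently of each other and without any regularity, so that the
   sections become functions; then tensor products of line bundles are
   pointwise products.  See line_bundle_of_cocycle below. *)
Record line_bundle (R : realType) (X : fspace R) := LineBundle {
  lsec : set X -> set (X -> R[i]);
  lsec_ext : forall U s t, {in U, s =1 t} -> lsec U s -> lsec U t;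
  lsec_sub : forall U V s, open U -> open V -> V `<=` U ->
    lsec U s -> lsec V s;
  lsec_glue : forall U s, open U ->
    (forall x, U x -> exists V, [/\ open V, V x, V `<=` U & lsec V s]) ->
    lsec U s;
  lsec_frame : forall x, exists U e, [/\ open U, U x & is_frame lsec U e]
}.

(* Presheaves of vector spaces: F(U) is the quotient of sec U by the elements
   of van U, which are those whose restriction to U vanishes; the restriction
   maps are induced by the identity of the carrier. *)
Record vsheaf (C : fieldType) (X : topologicalType) := VSheaf {
  carrier : lmodType C;
  sec : set X -> set carrier;
  van : set X -> set carrier;
  sec0 : forall U, open U -> sec U 0;
  sec_lin : forall U (a : C) s t, open U ->
    sec U s -> sec U t -> sec U (a *: s + t);
  sec_res : forall U V s, open U -> open V -> V `<=` U -> sec U s -> sec V s;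
  van0 : forall U, open U -> van U 0;
  van_lin : forall U (a : C) s t, open U ->
    van U s -> van U t -> van U (a *: s + t);
  van_res : forall U V s, open U -> open V -> V `<=` U -> van U s -> van V s
}.

Section Cech.
Variables (C : fieldType) (X : topologicalType).
Implicit Types F G : vsheaf C X.

Record H0 F := MkH0 { h0val :> carrier F; h0valP : sec setT h0val }.

(* Coverings indexed by the points of X are cofinal among all coverings, and
   they are directed for pointwise inclusion. *)
Definition covering (U : X -> set X) := forall x, open (U x) /\ U x x.

Definition cocycle F (U : X -> set X) (s : X -> X -> carrier F) :=
  (forall x y, sec (U x `&` U y) (s x y)) /\
  (forall x y z, van (U x `&` U y `&` U z) (s x z - (s x y + s y z))).

Definition coboundary F (U : X -> set X) (s : X -> X -> carrier F) :=
  exists t : X -> carrier F, (forall x, sec (U x) (t x)) /\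
    (forall x y, van (U x `&` U y) (s x y - (t x - t y))).

Definition z1 F : {pred X -> X -> carrier F} :=
  fun s => `[< exists U, covering U /\ cocycle U s >].
Definition b1 F : {pred X -> X -> carrier F} :=
  fun s => `[< exists U, covering U /\ coboundary U s >].

Lemma coveringI U V : covering U -> covering V ->
  covering (fun x => U x `&` V x).
Proof.
by move=> hU hV x; have [? ?] := hU x; have [? ?] := hV x; split => //; exact: openI.
Qed.

Lemma cocycle_sub F U V s : covering U -> covering V ->
  (forall x, V x `<=` U x) -> cocycle (F := F) U s -> cocycle (F := F) V s.
Proof.
move=> hU hV VU [s1 s2]; have oU x := proj1 (hU x); have oV x := proj1 (hV x).
split=> [x y|x y z].
- by apply: sec_res (s1 x y); [exact: openI|exact: openI|exact: setISS].
- apply: van_res (s2 x y z); try by do 2?apply: openI.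
  by apply: setISS => //; exact: setISS.
Qed.

Lemma coboundary_sub F U V s : covering U -> covering V ->
  (forall x, V x `<=` U x) -> coboundary (F := F) U s -> coboundary (F := F) V s.
Proof.
move=> hU hV VU [t [t1 t2]].
have oU x := proj1 (hU x); have oV x := proj1 (hV x).
exists t; split=> [x|x y]; first exact: sec_res (t1 x).
by apply: van_res (t2 x y); [exact: openI|exact: openI|exact: setISS].
Qed.

Lemma cocycle0 F U : covering U -> cocycle (F := F) U 0.
Proof.
move=> hU; have oU x := proj1 (hU x).
split=> [x y|x y z]; first by apply: sec0; exact: openI.
rewrite (_ : _ - _ = 0); first by apply: van0; do 2?apply: openI.
by rewrite -[(0 : X -> X -> carrier F) _ _]/0 addr0 subrr.
Qed.

Lemma cocycle_lin F U (a : C) s t : covering U ->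
  cocycle (F := F) U s -> cocycle (F := F) U t ->
  cocycle (F := F) U (a *: s + t).
Proof.
move=> hU [s1 s2] [t1 t2]; have oU x := proj1 (hU x).
split=> [x y|x y z]; first by apply: sec_lin => //; exact: openI.
have := van_lin a (openI (openI (oU x) (oU y)) (oU z)) (s2 x y z) (t2 x y z).
congr (van _ _); have lE u v : (a *: s + t) u v = a *: s u v + t u v by [].
by rewrite !lE scalerBr scalerDr addrACA -opprD [in LHS]addrACA.
Qed.

Lemma coboundary0 F U : covering U -> coboundary (F := F) U 0.
Proof.
move=> hU; have oU x := proj1 (hU x).
exists 0; split=> [x|x y]; first exact: sec0.
rewrite (_ : _ - _ = 0); first by apply: van0; exact: openI.
by rewrite -[(0 : X -> X -> carrier F) _ _]/0 -[(0 : X -> carrier F) _]/0 !subr0.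
Qed.

Lemma coboundary_lin F U (a : C) s t : covering U ->
  coboundary (F := F) U s -> coboundary (F := F) U t ->
  coboundary (F := F) U (a *: s + t).
Proof.
move=> hU [s' [s1 s2]] [t' [t1 t2]]; have oU x := proj1 (hU x).
exists (a *: s' + t'); split=> [x|x y]; first exact: sec_lin.
have := van_lin a (openI (oU x) (oU y)) (s2 x y) (t2 x y).
congr (van _ _).
have lE u v : (a *: s + t) u v = a *: s u v + t u v by [].
have lE' u : (a *: s' + t') u = a *: s' u + t' u by [].
by rewrite !lE !lE' !scalerBr addrACA -opprD; congr (_ - _); rewrite opprD addrACA.
Qed.

Lemma z1_closed F : submod_closed (z1 (F := F)).
Proof.
have hT : covering (fun=> setT) by move=> x; split => //; exact: openT.
split=> [|a s t /asboolP[U [hU sU]] /asboolP[V [hV tV]]].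
  by apply/asboolP; exists (fun=> setT); split => //; exact: cocycle0.
have hW := coveringI hU hV.
apply/asboolP; exists (fun x => U x `&` V x); split => //.
by apply: cocycle_lin => //; [exact: cocycle_sub sU|exact: cocycle_sub tV].
Qed.

Lemma b1_closed F : submod_closed (b1 (F := F)).
Proof.
have hT : covering (fun=> setT) by move=> x; split => //; exact: openT.
split=> [|a s t /asboolP[U [hU sU]] /asboolP[V [hV tV]]].
  by apply/asboolP; exists (fun=> setT); split => //; exact: coboundary0.
have hW := coveringI hU hV.
apply/asboolP; exists (fun x => U x `&` V x); split => //.
by apply: coboundary_lin => //; [exact: coboundary_sub sU|exact: coboundary_sub tV].
Qed.

HB.instance Definition _ F :=
  GRing.isSubmodClosed.Build C (X -> X -> carrier F) (z1 (F := F)) (z1_closed F).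

Record Z1 F := MkZ1 { z1val :> X -> X -> carrier F; z1valP : z1val \in z1 (F := F) }.
HB.instance Definition _ F := [isSub for @z1val F].
HB.instance Definition _ F := gen_eqMixin (Z1 F).
HB.instance Definition _ F := [Choice of Z1 F by <:].
HB.instance Definition _ F := [SubChoice_isSubLmodule of Z1 F by <:].

Definition B1 F : {pred Z1 F} := fun s => b1 (F := F) (z1val s).

Lemma B1_closed F : submod_closed (B1 (F := F)).
Proof.
by have [h0 hl] := b1_closed F; split=> [|a s t hs ht]; [exact: h0|exact: hl].
Qed.

HB.instance Definition _ F :=
  GRing.isSubmodClosed.Build C (Z1 F) (B1 (F := F)) (B1_closed F).

(* The filtered colimit over the coverings of cocycles modulo coboundaries:
   passing to the colimit is implicit, since the covering is existentially
   quantified in both z1 and b1. *)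
Definition H1 F := @Quotient.quot (Z1 F) (B1 (F := F)).
HB.instance Definition _ F := GRing.Zmodule.on (H1 F).

Definition H1pi F (s : Z1 F) : H1 F := \pi_(@Quotient.quot (Z1 F) (B1 (F := F))) s.

Lemma H1piP F (s t : Z1 F) : H1pi s = H1pi t <-> s - t \in B1 (F := F).
Proof. by rewrite Quotient.idealrBE; split=> [/eqP|/eqP]. Qed.

Lemma H1piD F : {morph @H1pi F : s t / s + t}.
Proof. by move=> s t; rewrite /H1pi [LHS]raddfD. Qed.

Lemma H1pi_repr F (w : H1 F) : H1pi (repr w) = w.
Proof. by rewrite /H1pi reprK. Qed.

Definition H1scale F (a : C) (w : H1 F) : H1 F := H1pi (a *: repr w).

Lemma H1piZ F a (s : Z1 F) : H1scale a (H1pi s) = H1pi (a *: s).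
Proof.
apply/H1piP; rewrite -scalerBr rpredZ //.
by apply/H1piP; rewrite H1pi_repr.
Qed.

Lemma H1scaleA F a b (w : H1 F) : H1scale a (H1scale b w) = H1scale (a * b) w.
Proof. by rewrite -(H1pi_repr w) !H1piZ scalerA. Qed.

Lemma H1scale1 F : left_id 1 (@H1scale F).
Proof. by move=> w; rewrite -(H1pi_repr w) H1piZ scale1r. Qed.

Lemma H1scaleDr F : right_distributive (@H1scale F) +%R.
Proof.
move=> a v w; rewrite -(H1pi_repr v) -(H1pi_repr w).
by rewrite -H1piD !H1piZ -H1piD scalerDr.
Qed.

Lemma H1scaleDl F (w : H1 F) : {morph (@H1scale F)^~ w : a b / a + b}.
Proof. by move=> a b; rewrite -(H1pi_repr w) !H1piZ -H1piD scalerDl. Qed.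

HB.instance Definition _ F := GRing.Zmodule_isLmodule.Build C (H1 F)
  (@H1scaleA F) (@H1scale1 F) (@H1scaleDr F) (@H1scaleDl F).

Lemma z1_of_cocycle F U (s : X -> X -> carrier F) :
  covering U -> cocycle U s -> s \in z1 (F := F).
Proof. by move=> hU hs; apply/asboolP; exists U. Qed.

Definition H1class F U (s : X -> X -> carrier F) (hU : covering U)
  (hs : cocycle U s) : H1 F := H1pi (MkZ1 (z1_of_cocycle hU hs)).

Definition represents F U (s : X -> X -> carrier F) (w : H1 F) : Prop :=
  exists (hU : covering U) (hs : cocycle U s), w = H1class hU hs.

Record vsheaf_hom F G := VSheafHom {
  hom_fun :> carrier F -> carrier G;
  hom_lin : linear hom_fun;
  hom_sec : forall U s, open U -> sec U s -> sec U (hom_fun s);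
  hom_van : forall U s, open U -> van U s -> van U (hom_fun s)
}.

Lemma hom_cocycle F G (phi : vsheaf_hom F G) U s :
  covering U -> cocycle U s -> cocycle U (fun x y => phi (s x y)).
Proof.
move=> hU [s1 s2]; have oU x := proj1 (hU x); split=> [x y|x y z].
  by apply: hom_sec (s1 x y); exact: openI.
have := hom_van phi (openI (openI (oU x) (oU y)) (oU z)) (s2 x y z).
have pD u v : phi (u + v) = phi u + phi v.
  by have := hom_lin phi 1 u v; rewrite !scale1r.
have pN u v : phi (u - v) = phi u - phi v.
  by rewrite addrC -scaleN1r hom_lin scaleN1r addrC.
by rewrite pN pD.
Qed.

Lemma hom_z1 F G (phi : vsheaf_hom F G) (s : Z1 F) :
  (fun x y => phi (z1val s x y)) \in z1 (F := G).
Proof.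
case: s => s /= /asboolP[U [hU hs]]; apply/asboolP; exists U.
by split=> //; exact: hom_cocycle.
Qed.

Definition H1map F G (phi : vsheaf_hom F G) (w : H1 F) : H1 G :=
  H1pi (MkZ1 (hom_z1 phi (repr w))).

End Cech.

Section LineBundles.
Variables (R : realType) (X : fspace R).
Local Notation C := R[i].

Section OfCocycle.
Variables (I : Type) (U : I -> set X) (nu : I -> I -> X -> C).
Hypothesis U_open : forall i, open (U i).
Hypothesis U_cover : forall x, exists i, U i x.
Hypothesis nu_reg : forall i j, reg (U i `&` U j) (nu i j).
Hypothesis nu_neq0 : forall i j x, U i x -> U j x -> nu i j x != 0.
Hypothesis nu_cocycle : forall i j k x, U i x -> U j x -> U k x ->
  nu i k x = nu i j x * nu j k x.

Let pt x : I := projT1 (cid (U_cover x)).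
Let U_pt x : U (pt x) x. Proof. exact: projT2 (cid (U_cover x)). Qed.

Definition cocycle_frame (j : I) (x : X) : C := nu (pt x) j x.
Definition cocycle_lsec (V : set X) : set (X -> C) :=
  [set s | forall j, reg (V `&` U j) (fun x => s x / cocycle_frame j x)].

Let frame_neq0 j x : U j x -> cocycle_frame j x != 0.
Proof. by move=> Ux; exact: nu_neq0. Qed.

Lemma cocycle_frameE i j x : U i x -> U j x ->
  cocycle_frame j x = nu i j x * cocycle_frame i x.
Proof. by move=> Ui Uj; rewrite mulrC; exact: nu_cocycle. Qed.

Let lsec_ext V s t : {in V, s =1 t} -> cocycle_lsec V s -> cocycle_lsec V t.
Proof.
move=> st hs j; apply: reg_ext (hs j) => x; rewrite inE => -[Vx _].
by rewrite st // inE.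
Qed.

Let lsec_sub V W s : open V -> open W -> W `<=` V ->
  cocycle_lsec V s -> cocycle_lsec W s.
Proof.
by move=> oV oW WV hs j; apply: reg_sub (hs j); [exact: openI|exact: openI|exact: setSI].
Qed.

Let lsec_glue V s : open V ->
  (forall x, V x -> exists W, [/\ open W, W x, W `<=` V & cocycle_lsec W s]) ->
  cocycle_lsec V s.
Proof.
move=> oV h j; apply: reg_glue => [|x [Vx Ux]]; first exact: openI.
have [W [oW Wx WV hW]] := h x Vx; exists (W `&` U j).
by split=> //; [exact: openI|exact: setSI].
Qed.

Lemma cocycle_is_frame i : is_frame cocycle_lsec (U i) (cocycle_frame i).
Proof.
split=> [x|V s oV VU]; first exact: frame_neq0.
split=> [/(_ i)|hs k]; first by rewrite setIidl.
have oVk : open (V `&` U k) by exact: openI.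
have VUk : V `&` U k `<=` U k `&` U i by move=> x [/VU].
have hs' : reg (V `&` U k) (fun x => s x / cocycle_frame i x).
  by apply: reg_sub hs => // x [].
have hnu := reg_sub (openI (U_open k) (U_open i)) oVk VUk (nu_reg k i).
apply: reg_ext (reg_mul oVk hs' hnu) => x; rewrite inE => -[Vx Ux] /=.
rewrite (cocycle_frameE Ux (VU x Vx)); have := frame_neq0 Ux.
have := nu_neq0 Ux (VU x Vx).
by move=> n0 f0; rewrite invfM -mulrA; congr (_ * _); rewrite mulrC mulrA mulfV // mul1r.
Qed.

Let lsec_frame x : exists V e, [/\ open V, V x & is_frame cocycle_lsec V e].
Proof.
exists (U (pt x)), (cocycle_frame (pt x)); split=> //; exact: cocycle_is_frame.
Qed.

(* On U i, the line bundle with transition functions (nu i j) has the frame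
   cocycle_frame i, and cocycle_frame j = nu i j * cocycle_frame i. *)
Definition line_bundle_of_cocycle : line_bundle X :=
  LineBundle lsec_ext lsec_sub lsec_glue lsec_frame.

End OfCocycle.

Lemma is_frame_sub F (U V : set X) e : V `<=` U ->
  is_frame F U e -> is_frame (X := X) F V e.
Proof.
move=> VU [e0 eP]; split=> [x /VU|W s oW WV]; first exact: e0.
by apply: eP => //; exact: subset_trans VU.
Qed.

Lemma reg_exp (U : set X) f b : open U -> reg U f -> reg U (fun x => f x ^+ b).
Proof.
move=> oU hf; elim: b => [|b IH].
  by apply: reg_ext (reg_cst 1 oU) => x _; rewrite expr0.
by apply: reg_ext (reg_mul oU hf IH) => x _; rewrite exprS.
Qed.

Variable L : line_bundle X.

Lemma frame_ratio (U V : set X) e f : open U -> open V ->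
  is_frame (lsec L) U e -> is_frame (lsec L) V f ->
  reg (U `&` V) (fun x => f x / e x).
Proof.
move=> oU oV [_ eP] [f0 fP]; have oUV := openI oU oV.
apply/(eP (U `&` V)) => //; apply/(fP (U `&` V)) => //.
apply: reg_ext (reg_cst 1 oUV) => x; rewrite inE => -[_ Vx].
by rewrite divff ?f0.
Qed.

Definition lpow (b : nat) (U : set X) : set (X -> C) :=
  [set s | forall x, U x -> exists V e,
     [/\ open V, V x, V `<=` U, is_frame (lsec L) V e &
         reg V (fun y => s y / e y ^+ b)]].

Lemma lpow_frame b U V s e : open U -> open V -> lpow b U s ->
  is_frame (lsec L) V e -> reg (U `&` V) (fun x => s x / e x ^+ b).
Proof.
move=> oU oV hs eP; apply: reg_glue => [|x [Ux Vx]]; first exact: openI.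
have [W [f [oW Wx WU fP hf]]] := hs x Ux.
exists (V `&` W); split; [exact: openI|by []|by move=> y [? /WU]|].
have oVW := openI oV oW.
have h1 : reg (V `&` W) (fun y => s y / f y ^+ b) by apply: reg_sub hf => // y [].
have h2 := reg_exp b oVW (frame_ratio oV oW eP fP).
apply: reg_ext (reg_mul oVW h1 h2) => y; rewrite inE => -[_ Wy] /=.
have f0 : f y ^+ b != 0 by rewrite expf_neq0 // fP.1.
by rewrite expr_div_n mulrA divfK.
Qed.

Lemma lpowI b U s : open U ->
  (forall x, U x -> exists V e, [/\ open V, V x, is_frame (lsec L) V e &
     reg (U `&` V) (fun y => s y / e y ^+ b)]) -> lpow b U s.
Proof.
move=> oU h x Ux; have [V [e [oV Vx eP hs]]] := h x Ux.
exists (U `&` V), e; split=> //; [exact: openI| by apply: is_frame_sub eP].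
Qed.

Lemma lpow_ext b U s t : open U -> {in U, s =1 t} -> lpow b U s -> lpow b U t.
Proof.
move=> oU st hs; apply: lpowI => // x Ux; have [V [e [oV Vx eP]]] := lsec_frame L x.
exists V, e; split=> //; apply: reg_ext (lpow_frame oU oV hs eP) => y.
by rewrite inE => -[Uy _]; rewrite st // inE.
Qed.

Lemma lpow_sub b U V s : open U -> open V -> V `<=` U -> lpow b U s -> lpow b V s.
Proof.
move=> oU oV VU hs; apply: lpowI => // x Ux; have [W [e [oW Wx eP]]] := lsec_frame L x.
exists W, e; split=> //; apply: reg_sub (lpow_frame oU oW hs eP);
  by [exact: openI|exact: openI|exact: setSI].
Qed.

Lemma lpow_glue b U s : open U ->
  (forall x, U x -> exists V, [/\ open V, V x, V `<=` U & lpow b V s]) ->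
  lpow b U s.
Proof.
move=> oU h x /h[V [oV Vx VU /(_ x Vx)[W [e [oW Wx WV eP hs]]]]].
by exists W, e; split=> //; exact: subset_trans VU.
Qed.

Lemma lpow0E U s : open U -> lpow 0 U s <-> reg U s.
Proof.
move=> oU; split=> hs.
  apply: reg_glue => // x Ux; have [V [e [oV Vx eP]]] := lsec_frame L x.
  exists (U `&` V); split=> //; [exact: openI|].
  by apply: reg_ext (lpow_frame oU oV hs eP) => y _; rewrite expr0 divr1.
apply: lpowI => // x Ux; have [V [e [oV Vx eP]]] := lsec_frame L x.
exists V, e; split=> //; apply: reg_ext (_ : reg _ s).
  by move=> y _; rewrite expr0 divr1.
by apply: reg_sub hs => //; exact: openI.
Qed.

Lemma lpow1E U s : open U -> lpow 1 U s <-> lsec L U s.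
Proof.
move=> oU; split=> hs.
  apply: lsec_glue => // x Ux; have [V [e [oV Vx eP]]] := lsec_frame L x.
  exists (U `&` V); split=> //; [exact: openI|].
  have oUV := openI oU oV; apply/(eP.2 (U `&` V)) => //.
  by apply: reg_ext (lpow_frame oU oV hs eP) => y _; rewrite expr1.
apply: lpowI => // x Ux; have [V [e [oV Vx eP]]] := lsec_frame L x.
have oUV := openI oU oV; exists V, e; split=> //.
have hr : reg (U `&` V) (fun y => s y / e y).
  by apply/(eP.2 (U `&` V)) => //; exact: lsec_sub hs.
by apply: reg_ext hr => y _; rewrite expr1.
Qed.

Lemma lpow_lin b U (a : C) s t : open U -> lpow b U s -> lpow b U t ->
  lpow b U (fun x => a * s x + t x).
Proof.
move=> oU hs ht; apply: lpowI => // x Ux.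
have [V [e [oV Vx eP]]] := lsec_frame L x; exists V, e; split=> //.
have oUV := openI oU oV.
have h1 := reg_mul oUV (reg_cst a oUV) (lpow_frame oU oV hs eP).
apply: reg_ext (reg_add oUV h1 (lpow_frame oU oV ht eP)) => y _ /=.
by rewrite mulrDl mulrA.
Qed.

Lemma lpow_mul b c U s t : open U -> lpow b U s -> lpow c U t ->
  lpow (b + c) U (fun x => s x * t x).
Proof.
move=> oU hs ht; apply: lpowI => // x Ux.
have [V [e [oV Vx eP]]] := lsec_frame L x; exists V, e; split=> //.
have oUV := openI oU oV.
apply: reg_ext (reg_mul oUV (lpow_frame oU oV hs eP) (lpow_frame oU oV ht eP)).
by move=> y _ /=; rewrite exprD invfM mulrACA.
Qed.

Lemma lpow_cst0 b U : open U -> lpow b U (fun=> 0).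
Proof.
move=> oU; apply: lpowI => // x Ux.
have [V [e [oV Vx eP]]] := lsec_frame L x; exists V, e; split=> //.
by apply: reg_ext (reg_cst 0 (openI oU oV)) => y _; rewrite mul0r.
Qed.

Definition Lpow (b : nat) : vsheaf C X.
Proof.
refine (@VSheaf C X (X -> C^o) (lpow b) (fun U => [set s | forall x, U x -> s x = 0])
  _ _ _ _ _ _).
- by move=> U; exact: lpow_cst0.
- by move=> U a s t; exact: lpow_lin.
- by move=> U V s; exact: lpow_sub.
- by [].
- by move=> U a s t oU hs ht x Ux; rewrite !fctE hs // ht // scaler0 addr0.
- by move=> U V s oU oV VU hs x /VU; exact: hs.
Defined.

(* The sections over U of the tensor product of the tangent sheaf with the
   b-th power of L: the C-derivations of the sheaf of algebras O_X|_U with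
   values in the sheaf of modules L^b|_U.  Being a morphism of sheaves amounts
   to the second condition: the value of D f depends only on f locally. *)
Definition is_derivation (b : nat) (U : set X) (D : (X -> C) -> X -> C) :=
  forall V, open V -> V `<=` U ->
  [/\ forall f, reg V f -> lpow b V (D f),
      forall f g, reg V f -> reg V g -> {in V, f =1 g} -> {in V, D f =1 D g},
      forall a f g, reg V f -> reg V g -> forall x, V x ->
        D (fun y => a * f y + g y) x = a * D f x + D g x &
      forall f g, reg V f -> reg V g -> forall x, V x ->
        D (f \* g) x = f x * D g x + g x * D f x].

Definition TLpow (b : nat) : vsheaf C X.
Proof.
refine (@VSheaf C X ((X -> C) -> X -> C^o) (is_derivation b)
  (fun U => [set D | forall V f, open V -> V `<=` U -> reg V f ->
                       forall x, V x -> D f x = 0]) _ _ _ _ _ _).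
- move=> U oU V oV VU.
  have l0 f x : (0 : (X -> C) -> X -> C^o) f x = 0 by [].
  split=> [f _|//|a f g _ _ x _|f g _ _ x _]; rewrite ?l0 ?mulr0 ?addr0 //.
  exact: lpow_cst0.
- move=> U a D E oU hD hE V oV VU.
  have [D1 D2 D3 D4] := hD V oV VU; have [E1 E2 E3 E4] := hE V oV VU.
  have lE f x : (a *: D + E) f x = a * D f x + E f x by [].
  split=> [f hf|f g hf hg fg x Vx|k f g hf hg x Vx|f g hf hg x Vx]; rewrite ?lE.
  + by apply: lpow_lin; [|exact: D1|exact: E1].
  + by rewrite (D2 f g) // (E2 f g).
  + by rewrite D3 // E3 // !mulrDr addrACA [a * (k * _)]mulrCA.
  + by rewrite D4 // E4 // !mulrDr addrACA [a * (f x * _)]mulrCA [a * (g x * _)]mulrCA.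
- by move=> U V D oU oV VU hD W oW WV; apply: hD => //; exact: subset_trans VU.
- by [].
- move=> U a D E oU hD hE V f oV VU hf x Vx.
  have -> : (a *: D + E) f x = a * D f x + E f x by [].
  by rewrite (hD V) // (hE V) // mulr0 addr0.
- by move=> U V D oU oV VU hD W f oW WV; apply: hD => //; exact: subset_trans VU.
Defined.

End LineBundles.

Section Differentials.
Variables (R : realType) (X : fspace R).
Local Notation C := R[i].

(* Tangent vectors at x, as derivations of the local ring of X at x. *)
Definition point_derivation (x : X) (v : (X -> C) -> C) :=
  forall V, open V -> V x ->
  [/\ forall f g, reg V f -> reg V g -> {in V, f =1 g} -> v f = v g,
      forall a f g, reg V f -> reg V g ->
        v (fun y => a * f y + g y) = a * v f + v g &
      forall f g, reg V f -> reg V g -> v (f \* g) = f x * v g + g x * v f].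

(* Regular differential forms: families of linear forms on the tangent spaces
   which are locally sums of f dg with f and g regular. *)
Definition is_form (U : set X) (w : X -> ((X -> C) -> C) -> C) :=
  forall x, U x -> exists V k (f g : 'I_k -> X -> C),
    [/\ open V, V x, V `<=` U, forall i, reg V (f i) /\ reg V (g i) &
        forall y v, V y -> point_derivation y v ->
          w y v = \sum_(i < k) f i y * v (g i)].

Lemma is_form_sub U V w : open U -> open V -> V `<=` U -> is_form U w -> is_form V w.
Proof.
move=> oU oV VU h x Vx; have [W [k [f [g [oW Wx WU hfg hw]]]]] := h x (VU x Vx).
exists (V `&` W), k, f, g; split=> //; first exact: openI.
- move=> i; have [hf hg] := hfg i; have oVW := openI oV oW.
  by split; [apply: reg_sub hf|apply: reg_sub hg].
- by move=> y v [Vy Wy]; exact: hw.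
Qed.

Definition Omega : vsheaf C X.
Proof.
refine (@VSheaf C X (X -> ((X -> C) -> C) -> C^o) is_form
  (fun U => [set w | forall x v, U x -> point_derivation x v -> w x v = 0])
  _ _ _ _ _ _).
- move=> U oU x Ux; exists U, 0, (fun _ _ => 0), (fun _ _ => 0); split=> //.
  + by case.
  + by move=> y v _ _; rewrite big_ord0.
- move=> U a s t oU hs ht x Ux.
  have [V [k [f [g [oV Vx VU hfg hw]]]]] := hs x Ux.
  have [W [l [f' [g' [oW Wx WU hfg' hw']]]]] := ht x Ux.
  have oVW := openI oV oW.
  exists (V `&` W), (k + l)%N,
    (fun i => match fintype.split i with inl i => (fun y => a * f i y) | inr i => f' i end),
    (fun i => match fintype.split i with inl i => g i | inr i => g' i end); split=> //.
  + by move=> y [/VU].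
  + move=> i; case: (fintype.split i) => {}i.
      have [hf hg] := hfg i; split; last by apply: reg_sub hg.
      by apply: (reg_mul oVW (reg_cst a oVW)); apply: reg_sub hf.
    by have [hf hg] := hfg' i; split; [apply: reg_sub hf|apply: reg_sub hg].
  + move=> y v [Vy Wy] hv.
    have -> : (a *: s + t) y v = a * s y v + t y v by [].
    rewrite hw // hw' // big_split_ord /= mulr_sumr.
    congr (_ + _); apply: eq_bigr => i _.
      case: fintype.splitP => j /= e; last by have := ltn_ord i; rewrite e ltnNge leq_addr.
      by rewrite (_ : j = i) ?mulrA //; apply/val_inj.
    case: fintype.splitP => j /= e; first by have := ltn_ord j; rewrite -e ltnNge leq_addr.
    by rewrite (_ : j = i) //; apply/val_inj/eqP; rewrite eq_sym -(eqn_add2l k) e.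
- exact: is_form_sub.
- by [].
- move=> U a s t oU hs ht x v Ux hv.
  have -> : (a *: s + t) x v = a * s x v + t x v by [].
  by rewrite hs // ht // mulr0 addr0.
- by move=> U V s oU oV VU hs x v /VU; exact: hs.
Defined.

Variable L : line_bundle X.

Lemma derivation_point b (D : H0 (TLpow L b)) x :
  point_derivation x (fun f => h0val D f x).
Proof.
case: D => D /= hD V oV Vx; have [_ D2 D3 D4] := hD V oV (@subsetT _ _).
split=> [f g hf hg fg|a f g hf hg|f g hf hg]; [|exact: D3|exact: D4].
by apply: D2 fg _ _ => //; rewrite inE.
Qed.

Definition contract (D : H0 (TLpow L 1)) (w : X -> ((X -> C) -> C) -> C^o) : X -> C^o :=
  fun x => w x (fun f => h0val D f x).

Definition contract_hom (D : H0 (TLpow L 1)) : vsheaf_hom Omega (Lpow L 1).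
Proof.
refine (@VSheafHom C X Omega (Lpow L 1) (contract D) _ _ _).
- by [].
- move=> U w oU hw; apply: lpow_glue => // x Ux.
  have [V [k [f [g [oV Vx VU hfg hw']]]]] := hw x Ux; exists V; split=> //.
  apply: (lpow_ext (s := fun y => \sum_(i < k) f i y * h0val D (g i) y)) => //.
    move=> y; rewrite inE => Vy.
    by rewrite /contract hw' //; exact: derivation_point.
  have h : forall r : seq 'I_k,
      lpow L 1 V (fun y => \sum_(i <- r) f i y * h0val D (g i) y).
    elim=> [|i r IH].
      by apply: lpow_ext (lpow_cst0 L 1 oV) => // y _; rewrite big_nil.
    have [hf hg] := hfg i.
    have hD : lpow L 1 V (h0val D (g i)).
      by have [+ _ _ _] := h0valP D _ oV (@subsetT _ _); apply.
    have hf0 : lpow L 0 V (f i) by apply/lpow0E.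
    apply: lpow_ext (lpow_lin 1 oV (lpow_mul oV hf0 hD) IH) => // y _.
    by rewrite big_cons mul1r.
  exact: h.
- by move=> U w oU hw x Ux; apply: hw => //; exact: derivation_point.
Defined.

Definition times_hom (D : H0 (TLpow L 1)) : vsheaf_hom (Lpow L 1) (TLpow L 2).
Proof.
refine (@VSheafHom C X (Lpow L 1) (TLpow L 2)
  (fun s f x => (s x : C) * h0val D f x) _ _ _).
- move=> a s t; apply/funext => f; apply/funext => x.
  by rewrite !fctE mulrDl /GRing.scale /= mulrA.
- move=> U s oU hs V oV VU; have [D1 D2 D3 D4] := h0valP D _ oV (@subsetT _ _).
  split=> [f hf|f g hf hg fg x Vx|a f g hf hg x Vx|f g hf hg x Vx].
  + apply: (lpow_mul (b := 1) (c := 1)) (D1 f hf) => //.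
    exact: lpow_sub hs.
  + by rewrite (D2 f g).
  + by rewrite D3 // mulrDr mulrCA.
  + by rewrite D4 // mulrDr mulrCA; congr (_ + _); rewrite mulrCA.
- by move=> U s oU hs V f oV VU hf x Vx; rewrite hs ?mul0r //; exact: VU.
Defined.

(* The two products, on H^0(T_X (x) L) x H^1(Omega_X) and on
   H^1(L) x H^0(T_X (x) L). *)
Definition pairing (D : H0 (TLpow L 1)) (w : H1 Omega) : H1 (Lpow L 1) :=
  H1map (contract_hom D) w.
Definition times (a : H1 (Lpow L 1)) (D : H0 (TLpow L 1)) : H1 (TLpow L 2) :=
  H1map (times_hom D) a.

Definition trivialization (U : X -> set X) (e : X -> X -> C) :=
  covering U /\ forall x, is_frame (lsec L) (U x) (e x).

(* The transition functions: e y = nu x y * e x on the intersection. *)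
Definition transition (e : X -> X -> C) (x y : X) : X -> C :=
  fun p => e y p / e x p.

(* d nu / nu *)
Definition dlog (nu : X -> X -> X -> C) (x y : X) : X -> ((X -> C) -> C) -> C^o :=
  fun p v => v (nu x y) / nu x y p.

Lemma dlog_cocycle U e : trivialization U e ->
  cocycle (F := Omega) U (dlog (transition e)).
Proof.
move=> [hU he]; have oU x := proj1 (hU x); split=> [x y p Up|x y z p v [[Ux Uy] Uz] hv].
  exists (U x `&` U y), 1, (fun _ => transition e y x), (fun _ => transition e x y).
  have oUI := openI (oU x) (oU y).
  split=> //.
  - move=> _; split; last exact: frame_ratio.
    by rewrite setIC; exact: frame_ratio.
  - by move=> q v _ _; rewrite big_ord1 /dlog mulrC /transition invf_div.
have o2 := openI (oU x) (oU y); have o3 := openI o2 (oU z).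
have [h1 h2 h3] := hv _ o3 (conj (conj Ux Uy) Uz).
have sub a b : U x `&` U y `&` U z `<=` U a `&` U b ->
    reg (U x `&` U y `&` U z) (transition e a b).
  by move=> hs; apply: reg_sub (frame_ratio (oU a) (oU b) (he a) (he b)) => //; exact: openI.
have rxy := sub x y (@subIsetl _ _ _).
have rxz : reg _ _ := sub x z (fun q (h : (U x `&` U y `&` U z) q) => conj h.1.1 h.2).
have ryz : reg _ _ := sub y z (fun q (h : (U x `&` U y `&` U z) q) => conj h.1.2 h.2).
have n0 a q : U a q -> e a q != 0 by move=> ?; apply: (he a).1.
have -> : (dlog (transition e) x z - (dlog (transition e) x y + dlog (transition e) y z)) p v
  = dlog (transition e) x z p v -
    (dlog (transition e) x y p v + dlog (transition e) y z p v) by [].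
have tr q : (U x `&` U y `&` U z) q ->
    transition e x z q = transition e x y q * transition e y z q.
  move=> [[Uxq Uyq] Uzq]; rewrite /transition.
  by rewrite [RHS]mulrC [RHS]mulrA divfK //; exact: n0.
have t0 a b : U a p -> U b p -> transition e a b p != 0.
  by move=> Ua Ub; rewrite mulf_neq0 ?invr_neq0 ?n0.
rewrite /dlog (h1 _ (transition e x y \* transition e y z) rxz (reg_mul o3 rxy ryz)).
  rewrite h3 // (tr p (conj (conj Ux Uy) Uz)).
  have := t0 _ _ Ux Uy; have := t0 _ _ Uy Uz.
  set a := transition e x y p; set b := transition e y z p.
  by move=> b0 a0; field; rewrite ?a0 ?b0.
by move=> q; rewrite inE => /tr.
Qed.

Definition frame_dom (x : X) : set X := projT1 (cid (lsec_frame L x)).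
Definition frame (x : X) : X -> C := projT1 (cid (projT2 (cid (lsec_frame L x)))).

Lemma frame_trivialization : trivialization frame_dom frame.
Proof.
have h x := projT2 (cid (projT2 (cid (lsec_frame L x)))).
by split=> x; have [? ? ?] := h x.
Qed.

(* The class does not depend on the chosen frames. *)
Definition nabla0 : H1 Omega :=
  H1class frame_trivialization.1 (dlog_cocycle frame_trivialization).

End Differentials.

Section Extensions.
Variables (R : realType) (X : fspace R).
Local Notation C := R[i].
Local Notation trunc n := {poly %/ ('X^n : {poly C})}.

Lemma coef_truncM n (p q : trunc n.+1) k : (k < n.+1)%N ->
  (p * q)`_k = ((p : {poly C}) * (q : {poly C}))`_k.
Proof.
move=> kn; rewrite poly_of_qpolyM.
have : mk_monic ('X^(n.+1) : {poly C}) = ('X^(n.+1) : {poly C}) by rewrite mk_monic_Xn.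
move: (_ * _) => r; move: (mk_monic _) => h ->.
by rewrite -Pdiv.RingMonic.take_poly_rmodp coef_take_poly kn.
Qed.

Lemma coef_trunc_ge n (p : trunc n.+1) k : (n < k)%N -> p`_k = 0.
Proof.
move=> nk; apply: nth_default.
have hs : size (mk_monic ('X^(n.+1) : {poly C})) = n.+2.
  by rewrite mk_monic_Xn size_polyXn.
by apply: leq_trans nk; rewrite -ltnS -hs; exact: size_mk_monic.
Qed.

(* A presheaf of subalgebras of the sheaf of all functions with values in
   C[t]/(t^n), where t is 'qX; the restriction maps are implicit. *)
Record alg_sheaf n := AlgSheaf {
  asec :> set X -> set (X -> trunc n);
  asec_lin : forall U (a : C) s t, open U -> asec U s -> asec U t ->
    asec U (fun x => a *: s x + t x);
  asec_mul : forall U s t, open U -> asec U s -> asec U t -> asec U (s \* t);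
  asec_one : forall U, open U -> asec U (fun=> 1)
}.

Lemma graded_sum (P : nat -> set X -> set (X -> C)) n
    (P0 : forall k U, open U -> P k U (fun=> 0))
    (Plin : forall k U (a : C) s t, open U -> P k U s -> P k U t ->
       P k U (fun x => a * s x + t x))
    (Pext : forall k U s t, open U -> {in U, s =1 t} -> P k U s -> P k U t)
    (Pmul : forall k l U s t, open U -> P k U s -> P l U t ->
       P (k + l)%N U (fun x => s x * t x))
    U (s t : X -> trunc n.+1) : open U ->
  (forall k, P k U (fun x => (s x)`_k)) -> (forall k, P k U (fun x => (t x)`_k)) ->
  forall k, P k U (fun x => ((s \* t) x)`_k).
Proof.
move=> oU hs ht k; have [kn|nk] := ltnP k n.+1; last first.
  by apply: (Pext _ _ (fun=> 0)) (P0 k U oU) => // x _; rewrite coef_trunc_ge.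
apply: (Pext _ _ (fun x => \sum_(i < k.+1) (s x)`_i * (t x)`_(k - i))) => //.
  by move=> x _; rewrite /= coef_truncM // coefM.
have h : forall r : seq 'I_k.+1, P k U (fun x => \sum_(i <- r) (s x)`_i * (t x)`_(k - i)).
  elim=> [|i r IH].
    by apply: (Pext _ _ (fun=> 0)) (P0 k U oU) => // x _; rewrite big_nil.
  apply: (Pext _ _ (fun x => 1 * ((s x)`_i * (t x)`_(k - i)) +
     \sum_(i <- r) (s x)`_i * (t x)`_(k - i))) => // [x _|].
    by rewrite big_cons mul1r.
  apply: Plin => //; have := Pmul _ _ _ _ _ oU (hs i) (ht (k - i)%N).
  by rewrite subnKC // -ltnS.
exact: h.
Qed.

(* O_X[t]/(t^(n+1)) *)
Definition Otrunc n : alg_sheaf n.+1.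
Proof.
refine (@AlgSheaf n.+1 (fun U => [set s | forall k, reg U (fun x => (s x)`_k)]) _ _ _).
- move=> U a s t oU hs ht k.
  apply: reg_ext (reg_add oU (reg_mul oU (reg_cst a oU) (hs k)) (ht k)) => x _ /=.
  by rewrite coefD coefZ.
- move=> U s t oU hs ht.
  apply: (graded_sum (P := fun _ U => @reg R X U)) => //.
  + by move=> _ V; exact: reg_cst.
  + move=> _ V a f g oV hf hg.
    by apply: (reg_add oV) => //; apply: (reg_mul oV (reg_cst a oV)).
  + by move=> _ V f g oV; exact: reg_ext.
  + by move=> _ _ V f g oV; exact: reg_mul.
- by move=> U oU k; exact: reg_cst.
Defined.

(* The structure sheaf of the first n infinitesimal neighbourhoods of the zero
   section in the total space of the dual of L, which is the direct sum of the
   powers L^k, for k <= n, with the multiplication of the symmetric algebra: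
   a section of L^k is the coefficient of t^k.  For n = 1 it is the structure
   sheaf of the trivial primitive double scheme X_2. *)
Definition Ltrunc (L : line_bundle X) n : alg_sheaf n.+1.
Proof.
refine (@AlgSheaf n.+1 (fun U => [set s | forall k, lpow L k U (fun x => (s x)`_k)]) _ _ _).
- move=> U a s t oU hs ht k.
  apply: lpow_ext (lpow_lin a oU (hs k) (ht k)) => // x _ /=.
  by rewrite coefD coefZ.
- move=> U s t oU hs ht.
  apply: (graded_sum (P := lpow L)) => //.
  + by move=> k V; exact: lpow_cst0.
  + by move=> k V a f g oV; exact: lpow_lin.
  + by move=> k V f g oV; exact: lpow_ext.
  + by move=> k l V f g oV; exact: lpow_mul.
- move=> U oU [|k].
    by apply/lpow0E => //; apply: reg_cst.
  by apply: lpow_ext (lpow_cst0 L k.+1 oU) => // x _; rewrite coefC.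
Defined.

(* Endomorphisms, over C, of the sheaf of algebras A|_U which induce the
   identity modulo t.  As for derivations, the second condition amounts to
   being a morphism of sheaves, and only the values on sections matter. *)
Definition is_endo n (A : alg_sheaf n) (U : set X)
    (phi : (X -> trunc n) -> X -> trunc n) :=
  forall V, open V -> V `<=` U ->
  [/\ forall s, A V s -> A V (phi s),
      forall s t, A V s -> A V t -> {in V, s =1 t} -> {in V, phi s =1 phi t},
      forall (a : C) s t, A V s -> A V t -> forall x, V x ->
        phi (fun y => a *: s y + t y) x = a *: phi s x + phi t x,
      (forall s t, A V s -> A V t -> forall x, V x ->
         phi (s \* t) x = phi s x * phi t x) /\
      (forall x, V x -> phi (fun=> 1) x = 1) &
      forall s, A V s -> forall x, V x -> (phi s x)`_0 = (s x)`_0].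

Record alg_aut n (A : alg_sheaf n) (U : set X) := AlgAut {
  aut_fun :> (X -> trunc n) -> X -> trunc n;
  aut_invfun : (X -> trunc n) -> X -> trunc n;
  aut_endo : is_endo A U aut_fun;
  aut_invendo : is_endo A U aut_invfun;
  aut_cancel : forall V s, open V -> V `<=` U -> A V s ->
    {in V, aut_invfun (aut_fun s) =1 s} /\ {in V, aut_fun (aut_invfun s) =1 s}
}.

Section Group.
Variables (n : nat) (A : alg_sheaf n).

Lemma endo_comp U phi psi :
  is_endo A U phi -> is_endo A U psi -> is_endo A U (phi \o psi).
Proof.
move=> hphi hpsi V oV VU.
have [p1 p2 p3 [p4 p4'] p5] := hphi V oV VU.
have [q1 q2 q3 [q4 q4'] q5] := hpsi V oV VU.
have eqV s t : (forall x, V x -> s x = t x) -> {in V, s =1 t :> (X -> trunc n)}.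
  by move=> st x; rewrite inE; exact: st.
have inV x : V x -> x \in V by rewrite inE.
split=> [s hs|s t hs ht st|a s t hs ht x Vx| |s hs x Vx] /=.
- exact/p1/q1.
- by apply: p2; [exact: q1|exact: q1|exact: q2].
- rewrite -p3; [|exact: q1|exact: q1|by []].
  apply: (p2 _ _ _ _ _ x (inV _ Vx)).
  + by apply: q1; exact: asec_lin.
  + by apply: asec_lin => //; exact: q1.
  + by apply: eqV; exact: q3.
- split=> [s t hs ht x Vx|x Vx].
    rewrite -p4; [|exact: q1|exact: q1|by []].
    apply: (p2 _ _ _ _ _ x (inV _ Vx)).
    + by apply: q1; exact: asec_mul.
    + by apply: asec_mul => //; exact: q1.
    + by apply: eqV; exact: q4.
  rewrite -[RHS](p4' x Vx); apply: (p2 _ _ _ _ _ x (inV _ Vx)).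
  + by apply: q1; exact: asec_one.
  + exact: asec_one.
  + by apply: eqV; exact: q4'.
- by rewrite p5 ?q5 //; exact: q1.
Qed.

Lemma endo_res U V phi : V `<=` U -> is_endo A U phi -> is_endo A V phi.
Proof. by move=> VU h W oW WV; apply: h => //; exact: subset_trans VU. Qed.

Definition aut_inv U (phi : alg_aut A U) : alg_aut A U.
Proof.
refine (AlgAut (aut_invendo phi) (aut_endo phi) _).
by move=> V s oV VU hs; have [? ?] := aut_cancel phi oV VU hs.
Defined.

Definition aut_mul U (phi psi : alg_aut A U) : alg_aut A U.
Proof.
refine (AlgAut (endo_comp (aut_endo phi) (aut_endo psi))
               (endo_comp (aut_invendo psi) (aut_invendo phi)) _).
move=> V s oV VU hs.
have [e1 e2 _ _ _] := aut_endo phi oV VU.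
have [f1 f2 _ _ _] := aut_endo psi oV VU.
have [e1' e2' _ _ _] := aut_invendo phi oV VU.
have [f1' f2' _ _ _] := aut_invendo psi oV VU.
split=> x Vx /=.
- have [hc _] := aut_cancel psi oV VU hs; rewrite -[RHS]hc //.
  have [hd _] := aut_cancel phi oV VU (f1 s hs).
  by apply: f2' hd _ Vx; [exact/e1'/e1/f1|exact: f1].
- have [_ hc] := aut_cancel phi oV VU hs; rewrite -[RHS]hc //.
  have [_ hd] := aut_cancel psi oV VU (e1' s hs).
  by apply: e2 hd _ Vx; [exact/f1/f1'/e1'|exact: e1'].
Defined.

Definition aut_res U V (VU : V `<=` U) (phi : alg_aut A U) : alg_aut A V :=
  AlgAut (endo_res VU (aut_endo phi)) (endo_res VU (aut_invendo phi))
    (fun W s oW WV => aut_cancel phi oW (subset_trans WV VU)).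

End Group.

Definition G2 (U : set X) := alg_aut (Otrunc 1) U.
Definition G3 (U : set X) := alg_aut (Otrunc 2) U.

Variable L : line_bundle X.

(* Automorphisms of X_2 inducing the identity on X. *)
Definition Aut2 := alg_aut (Ltrunc L 1) setT.

(* Those inducing the identity on the ideal sheaf L of X, whose sections are
   the l t with l a section of L. *)
Record Aut02 := MkAut02 {
  aut02_val :> Aut2;
  aut02P : forall V l, open V -> lsec L V l ->
    {in V, aut02_val (fun x => l x *: 'qX) =1 (fun x => l x *: 'qX)}
}.

Definition derivation_fun (chi : Aut2) : (X -> C) -> X -> C :=
  fun f x => (chi (fun y => (f y)%:A) x)`_1.

Lemma Ltrunc_cst V f : open V -> reg V f -> Ltrunc L 1 V (fun y => (f y)%:A).
Proof.
move=> oV hf [|k].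
  apply/lpow0E => //; apply: reg_ext hf => x _.
  by rewrite coefZ coefC mulr1.
apply: lpow_ext (lpow_cst0 L k.+1 oV) => // x _.
by rewrite coefZ coefC mulr0.
Qed.

Lemma derivation_funP (chi : Aut2) : is_derivation L 1 setT (derivation_fun chi).
Proof.
move=> V oV VT; have [p1 p2 p3 [p4 _] p5] := aut_endo chi oV VT.
have cstP f : reg V f -> Ltrunc L 1 V (fun y => (f y)%:A) by exact: Ltrunc_cst.
split=> [f hf|f g hf hg fg x Vx|a f g hf hg x Vx|f g hf hg x Vx].
- exact: (p1 _ (cstP f hf) 1).
- rewrite /derivation_fun (p2 _ _ (cstP f hf) (cstP g hg)) // => y Vy.
  by rewrite fg.
- have -> : derivation_fun chi (fun y => a * f y + g y) x =
      (chi (fun y => a *: (f y)%:A + (g y)%:A) x)`_1.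
    rewrite /derivation_fun; congr (polyn _)`_1; congr (aut_fun chi _ _).
    by apply/funext => y; rewrite scalerDl scalerA.
  have cE (p q : trunc 2) : (a *: p + q)`_1 = a * p`_1 + q`_1.
    by rewrite /= coefD coefZ.
  by rewrite p3; [exact: cE|exact: cstP|exact: cstP|by []].
- have -> : derivation_fun chi (f \* g) x =
      (chi ((fun y => (f y)%:A : trunc 2) \* (fun y => (g y)%:A)) x)`_1.
    have cM (a b : C) : (a * b)%:A = a%:A * b%:A :> trunc 2.
      rewrite -in_qpoly1 -!in_qpolyZ -in_qpolyM; congr in_qpoly.
      by rewrite -!scalerAl mul1r scalerA.
    congr (_`_1); congr (polyn (aut_fun chi _ _)).
    by apply/funext => y; exact: cM.
  rewrite p4; [|exact: cstP|exact: cstP|by []].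
  have p0 h : reg V h -> (chi (fun y => (h y)%:A) x)`_0 = h x.
    move=> hh; have cA (a : C) : (a%:A : trunc 2)`_0 = a by rewrite coefZ coefC mulr1.
    by rewrite (p5 _ (cstP h hh) x Vx).
  rewrite coef_truncM // coefM !big_ord_recl big_ord0 addr0.
  rewrite /= !p0 // /derivation_fun; congr (_ + _); exact: mulrC.
Qed.

(* The section of T_X (x) L corresponding to chi: chi^*(f) = f + D(f) t. *)
Definition derivation_of (chi : Aut02) : H0 (TLpow L 1) :=
  MkH0 (F := TLpow L 1) (derivation_funP chi).

(* The isomorphism from O_X[t]/(t^2) to the structure sheaf of X_2, over an
   open set where e is a frame of L: it maps t to e. *)
Definition trivialize (e : X -> C) (s : X -> trunc 2) : X -> trunc 2 :=
  fun x => ((s x)`_0)%:A + ((s x)`_1 * e x) *: 'qX.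

Definition local_expression (chi : Aut2) U (e : X -> C) (phi : G2 U) :=
  forall V s, open V -> V `<=` U -> Otrunc 1 V s -> forall x, V x ->
    chi (trivialize e s) x = trivialize e (phi s) x.

Definition reduce (s : X -> trunc 3) : X -> trunc 2 :=
  fun x => in_qpoly 'X^2 (s x).

Definition is_lift U (c : G3 U) (phi : G2 U) :=
  forall V s, open V -> V `<=` U -> Otrunc 2 V s -> forall x, V x ->
    reduce (c s) x = phi (reduce s) x.

(* phi maps f to E f, for f in O_X, and t to tau. *)
Definition maps_to U (phi : G3 U) (E : (X -> C) -> X -> trunc 3)
    (tau : X -> trunc 3) :=
  (forall V f, open V -> V `<=` U -> reg V f -> forall x, V x ->
     phi (fun y => (f y)%:A) x = E f x) /\
  forall x, U x -> phi (fun=> 'qX) x = tau x.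

(* f |-> f, t |-> nu t *)
Definition is_transition U (nu : X -> C) (g : G3 U) :=
  maps_to g (fun f x => (f x)%:A) (fun x => nu x *: 'qX).

(* The element of the kernel of G_3 -> G_2 given by
   f |-> f + eps(f) t^2, t |-> (1 + eta t) t. *)
Definition is_kernel_elt U (eta : X -> C) (eps : (X -> C) -> X -> C) (g : G3 U) :=
  maps_to g (fun f x => (f x)%:A + eps f x *: 'qX ^+ 2)
            (fun x => (1 + eta x *: 'qX) * 'qX).

(* Cochains of L and T_X (x) L^2 with values s x y on U x `&` U y, from their
   coordinates in the frame e x on U x.  As e y = nu x y * e x, they are
   cocycles if and only if the coordinates satisfy
   s x z = s x y + nu x y ^+ b * s y z with b = 1, 2 respectively. *)
Definition L_cochain (e : X -> X -> C) (eta : X -> X -> X -> C) :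
    X -> X -> carrier (Lpow L 1) :=
  fun x y p => eta x y p * e x p.
Definition TL2_cochain (e : X -> X -> C) (eps : X -> X -> (X -> C) -> X -> C) :
    X -> X -> carrier (TLpow L 2) :=
  fun x y f p => eps x y f p * e x p ^+ 2.

Definition gamma_represents U e eta eps
    (gamma : H1 (Lpow L 1) * H1 (TLpow L 2)) :=
  represents U (L_cochain e eta) gamma.1 /\
  represents U (TL2_cochain e eps) gamma.2.

Definition theta (U : X -> set X) (c : forall x, G3 (U x))
    (gam g : forall x y, G3 (U x `&` U y)) x y : G3 (U x `&` U y) :=
  aut_mul (aut_mul (aut_mul (aut_mul
    (aut_res (@subIsetl _ _ _) (c x)) (gam x y)) (g x y))
    (aut_inv (aut_res (@subIsetr _ _ _) (c y)))) (aut_inv (g x y)).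

(* gamma' is the class defined by the theta x y, for some choice of a
   covering, of frames, of cocycles and of lifts. *)
Definition action_rel (chi : Aut2) (gamma gamma' : H1 (Lpow L 1) * H1 (TLpow L 2)) :=
  exists (U : X -> set X) (e : X -> X -> C)
         (eta : X -> X -> X -> C) (eps : X -> X -> (X -> C) -> X -> C)
         (eta' : X -> X -> X -> C) (eps' : X -> X -> (X -> C) -> X -> C)
         (chi_ : forall x, G2 (U x)) (c : forall x, G3 (U x))
         (gam g : forall x y, G3 (U x `&` U y)),
    [/\ trivialization L U e,
        gamma_represents U e eta eps gamma,
        forall x, local_expression chi (e x) (chi_ x) /\ is_lift (c x) (chi_ x),
        forall x y, is_transition (transition e x y) (g x y) /\
                    is_kernel_elt (eta x y) (eps x y) (gam x y) &
        (forall x y, is_kernel_elt (eta' x y) (eps' x y) (theta c gam g x y)) /\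
        gamma_represents U e eta' eps' gamma'].

(* action_rel is the graph of a function: the class does not depend on the
   choices.  Its value is selected with xget. *)
Definition action (chi : Aut2) (gamma : H1 (Lpow L 1) * H1 (TLpow L 2)) :
    H1 (Lpow L 1) * H1 (TLpow L 2) :=
  xget (0, 0) [set gamma' | action_rel chi gamma gamma'].

End Extensions.

(* Main.v *)
(* An automorphism of O_X[t]/(t^3) inducing the identity on O_X is determined by
   the images f + A f t + B f t^2 of the functions f and u t + v t^2 of t, where
   A is a derivation and B(fg) = f B g + A f A g + g B f.  Comparing these data
   on both sides of theta g c_j = c_i gamma g, for c_i a lift of chi with
   A = D_i = D / e_i, B = E_i, u = 1, v = a_i, and nu = e_j / e_i, one gets
     eta' = eta + D_i nu / nu + a_i - nu a_j,
     eps' = eps + E_i - nu^2 E_j - eta' D_i.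
   Now E_i - D_i^2 / 2 is a derivation, and
     D_i^2 - nu^2 D_j^2 = (D_i nu / nu) D_i,
   so that, up to the coboundaries of (a_i) and of (E_i - D_i^2 / 2 - a_i D_i),
   this is the asserted formula. *)
Require Import Defs.
From mathcomp Require Import all_boot all_order all_algebra.
From mathcomp Require Import qpoly.
From mathcomp Require Import ring.
From mathcomp Require Import all_classical reals topology complex.
Set Implicit Arguments. Unset Strict Implicit. Unset Printing Implicit Defensive.
Import GRing.Theory.
Local Open Scope classical_set_scope.
Local Open Scope ring_scope.

(** * Truncated polynomials *)

(** [action] selects its value with [xget], which falls back on (0, 0) when nothing is related to
    gamma. Hence two facts are needed: every value related to gamma is the asserted one, and some
    value is related to it. For the second, all local data must exist as automorphisms with explicit
    inverses, over one covering that carries frames and both cocycles; chi is lifted there by exp (t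
    D_i). Comparing both sides of theta g c_j = c_i gamma g, instead of expanding theta, avoids
    computing the coefficients of any inverse. The constant in the formula is 1/2 - 1: the term -
    eta' D_i contributes - (D_i nu / nu) D_i, while the parts D_i^2 / 2 of E_i and D_j^2 / 2 of E_j
    give back half of it. The correction by D_i^2 / 2 is forced, because E_i is not a derivation and
    so is not a cochain of T_X (x) L^2. The remaining term (a_i - nu a_j) D_i is a coboundary
    because D_i = nu D_j. *)

Section Truncated.
Variable R : realType.
Local Notation C := R[i].
Local Notation trunc n := {poly %/ ('X^n : {poly C})}.

Definition tcoef n (k : nat) (p : trunc n) : C := p`_k.
Definition tconst n (a : C) : trunc n := a%:A.
Definition tvar n : trunc n := 'qX.

Lemma tcoef_eq n (p q : trunc n.+1) :
  (forall k, (k < n.+1)%N -> tcoef k p = tcoef k q) -> p = q.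
Proof.
move=> pq; apply/npolyP => k; have [/pq//|nk] := ltnP k n.+1.
by rewrite !coef_trunc_ge.
Qed.

Lemma tcoef_in n (p : {poly C}) k :
  tcoef k (in_qpoly 'X^(n.+1) p : trunc n.+1) = if (k < n.+1)%N then p`_k else 0.
Proof.
rewrite /tcoef /= mk_monic_Xn /= -Pdiv.RingMonic.take_poly_rmodp.
by rewrite coef_take_poly.
Qed.

Lemma tcoef_const n (a : C) k : tcoef k (tconst n a) = a * (k == 0)%:R.
Proof. by rewrite /tcoef coefZ coefC; case: k. Qed.

Lemma tcoef_one n (k : nat) : tcoef k (1 : trunc n) = (k == 0)%:R.
Proof. by rewrite -[1]scale1r (tcoef_const n 1) mul1r. Qed.

Lemma tcoef_var n k : tcoef k (tvar n.+2) = (k == 1)%:R.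
Proof. by rewrite tcoef_in coefX; case: k => [|[|k]] //; case: ifP. Qed.

Lemma tcoefD n (p q : trunc n) k : tcoef k (p + q) = tcoef k p + tcoef k q.
Proof. exact: coefD. Qed.

Lemma tcoefZ n (a : C) (p : trunc n) k : tcoef k (a *: p) = a * tcoef k p.
Proof. exact: coefZ. Qed.

Lemma tcoefM0 n (p q : trunc n.+1) : tcoef 0 (p * q) = tcoef 0 p * tcoef 0 q.
Proof. by rewrite /tcoef coef_truncM // coefM big_ord1. Qed.

Lemma tcoefM1 n (p q : trunc n.+2) :
  tcoef 1 (p * q) = tcoef 0 p * tcoef 1 q + tcoef 1 p * tcoef 0 q.
Proof. by rewrite /tcoef coef_truncM // coefM !big_ord_recl big_ord0 addr0. Qed.

Lemma tcoefM2 n (p q : trunc n.+3) : tcoef 2 (p * q) =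
  tcoef 0 p * tcoef 2 q + tcoef 1 p * tcoef 1 q + tcoef 2 p * tcoef 0 q.
Proof.
by rewrite /tcoef coef_truncM // coefM !big_ord_recl big_ord0 addr0 addrA.
Qed.

Definition jet n (a : nat -> C) : trunc n.+1 := in_qpoly 'X^(n.+1) (\poly_(k < n.+1) a k).

Lemma tcoef_jet n a k : tcoef k (jet n a) = if (k < n.+1)%N then a k else 0.
Proof. by rewrite tcoef_in coef_poly; case: ltnP. Qed.

(** The coefficients enter as constants multiplied by powers of t, not as scalars: over an open set
    they are functions, which an endomorphism moves, so it has to be distributed by
    multiplicativity. *)
Lemma trunc3_decomp (p : trunc 3) :
  p = tconst 3 (tcoef 0 p) + tconst 3 (tcoef 1 p) * tvar 3
      + tconst 3 (tcoef 2 p) * (tvar 3 * tvar 3).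
Proof.
apply: tcoef_eq => k.
case: k => [|[|[|k]]] // _; rewrite 2!tcoefD.
- rewrite !tcoefM0 !tcoef_const tcoef_var /=.
  ring.
- rewrite !tcoefM1 !tcoefM0 !tcoef_const !tcoef_var /=.
  ring.
- rewrite !tcoefM2 !tcoefM1 !tcoefM0 !tcoef_const !tcoef_var /=.
  ring.
Qed.

End Truncated.

(** * Endomorphisms of O_X[t]/(t^3) *)

Section Jets.
Variables (R : realType) (X : fspace R).
Local Notation C := R[i].
Local Notation trunc n := {poly %/ ('X^n : {poly C})}.
Implicit Types (U V : set X) (f g u v : X -> C) (A B : (X -> C) -> X -> C).

(* Equivalently, f + A f t + B f t^2 is linear and multiplicative in f. *)
Definition is_hasse U A B := forall V, open V -> V `<=` U ->
  [/\ forall f, reg V f -> reg V (A f) /\ reg V (B f),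
      forall f g, reg V f -> reg V g -> {in V, f =1 g} -> forall x, V x ->
        A f x = A g x /\ B f x = B g x,
      forall a f g, reg V f -> reg V g -> forall x, V x ->
        A (fun y => a * f y + g y) x = a * A f x + A g x /\
        B (fun y => a * f y + g y) x = a * B f x + B g x &
      forall f g, reg V f -> reg V g -> forall x, V x ->
        A (f \* g) x = f x * A g x + g x * A f x /\
        B (f \* g) x = f x * B g x + A f x * A g x + g x * B f x].

Definition coefs n (s : X -> trunc n) k : X -> C := fun y => tcoef k (s y).

Lemma OtruncP n V (s : X -> trunc n.+1) : open V ->
  Otrunc X n V s <-> forall k, (k < n.+1)%N -> reg V (coefs s k).
Proof.
move=> oV; split=> [hs k _|hs k]; first exact: hs.
have [/hs//|nk] := ltnP k n.+1.
by apply: reg_ext (reg_cst 0 oV) => x _; rewrite coef_trunc_ge.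
Qed.

Lemma Otrunc_const n V f : open V -> reg V f -> Otrunc X n V (fun y => tconst n.+1 (f y)).
Proof.
move=> oV hf; apply/OtruncP => // k _.
apply: reg_ext (reg_mul oV hf (reg_cst (k == 0)%:R oV)) => x _.
by rewrite /coefs tcoef_const.
Qed.

Lemma Otrunc_var n V : open V -> Otrunc X n.+1 V (fun=> tvar R n.+2).
Proof.
move=> oV; apply/OtruncP => // k _.
by apply: reg_ext (reg_cst (k == 1)%:R oV) => x _; rewrite /coefs tcoef_var.
Qed.

(** The product rule for 1 = 1 * 1 reads A 1 = 2 A 1, and then B 1 = 2 B 1 since A 1 = 0. *)
Lemma hasse1 U V A B x : is_hasse U A B -> open V -> V `<=` U -> V x ->
  A (fun=> 1) x = 0 /\ B (fun=> 1) x = 0.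
Proof.
move=> h oV VU Vx; have [_ h2 _ h4] := h V oV VU.
have r1 := reg_cst 1 oV.
have [e1 e2] := h4 _ _ r1 r1 x Vx.
have eq1 : {in V, (fun=> 1 : C) \* (fun=> 1) =1 (fun=> 1)} by move=> y _; rewrite /= mul1r.
have [f1 f2] := h2 _ _ (reg_mul oV r1 r1) r1 eq1 x Vx.
move: e1; rewrite f1 !mul1r => /eqP; rewrite eq_sym -subr_eq0 addrK => /eqP A1.
move: e2; rewrite f2 A1 mul0r addr0 !mul1r => /eqP.
by rewrite eq_sym -subr_eq0 addrK => /eqP.
Qed.

(* The endomorphism f |-> f + A f t + B f t^2, t |-> u t + v t^2. *)
Definition jet_map A B u v (s : X -> trunc 3) : X -> trunc 3 := fun x =>
  jet 2 (fun k => match k with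
    | 0 => tcoef 0 (s x)
    | 1 => A (coefs s 0) x + u x * tcoef 1 (s x)
    | _ => B (coefs s 0) x + (v x * tcoef 1 (s x) + u x * A (coefs s 1) x)
           + u x ^+ 2 * tcoef 2 (s x)
    end).

Lemma jet_map0 A B u v s x : tcoef 0 (jet_map A B u v s x) = tcoef 0 (s x).
Proof. by rewrite tcoef_jet. Qed.

Lemma jet_map1 A B u v s x : tcoef 1 (jet_map A B u v s x) =
  A (coefs s 0) x + u x * tcoef 1 (s x).
Proof. by rewrite tcoef_jet. Qed.

Lemma jet_map2 A B u v s x : tcoef 2 (jet_map A B u v s x) =
  B (coefs s 0) x + (v x * tcoef 1 (s x) + u x * A (coefs s 1) x)
  + u x ^+ 2 * tcoef 2 (s x).
Proof. by rewrite tcoef_jet. Qed.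

Lemma jet_map_endo U A B u v : open U -> is_hasse U A B -> reg U u -> reg U v ->
  is_endo (Otrunc X 2) U (jet_map A B u v).
Proof.
move=> oU h hu hv V oV VU; have [h1 h2 h3 h4] := h V oV VU.
have {}hu : reg V u by apply: reg_sub hu.
have {}hv : reg V v by apply: reg_sub hv.
split=> [s /OtruncP-/(_ oV) hs|s t /OtruncP-/(_ oV) hs /OtruncP-/(_ oV) ht st x|
  a s t /OtruncP-/(_ oV) hs /OtruncP-/(_ oV) ht x Vx||s hs x Vx].
- have [A0 B0] := h1 _ (hs 0 isT); have [A1 _] := h1 _ (hs 1 isT).
  apply/OtruncP => // -[|[|[|k]]] // _.
  + by apply: reg_ext (hs 0 isT) => x _; rewrite /coefs jet_map0.
  + by apply: reg_ext (reg_add oV A0 (reg_mul oV hu (hs 1 isT))) => x _;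
      rewrite /coefs jet_map1.
  + apply: reg_ext (reg_add oV (reg_add oV B0 (reg_add oV (reg_mul oV hv (hs 1 isT))
      (reg_mul oV hu A1))) (reg_mul oV (reg_exp 2 oV hu) (hs 2 isT))) => x _.
    by rewrite /coefs jet_map2.
- rewrite inE => Vx; have stx : s x = t x by apply: st; rewrite inE.
  have stk k : {in V, coefs s k =1 coefs t k} by move=> y Vy; rewrite /coefs st.
  have [A0 B0] := h2 _ _ (hs 0 isT) (ht 0 isT) (stk 0) x Vx.
  have [A1 _] := h2 _ _ (hs 1 isT) (ht 1 isT) (stk 1) x Vx.
  apply: tcoef_eq => -[|[|[|k]]] // _.
  + by rewrite !jet_map0 stx.
  + by rewrite !jet_map1 A0 stx.
  + by rewrite !jet_map2 A1 B0 stx.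
- have cE k : coefs (fun y => a *: s y + t y) k = fun y => a * coefs s k y + coefs t k y.
    by apply/funext => y; rewrite /coefs tcoefD tcoefZ.
  have [A0 B0] := h3 a _ _ (hs 0 isT) (ht 0 isT) x Vx.
  have [A1 _] := h3 a _ _ (hs 1 isT) (ht 1 isT) x Vx.
  apply: tcoef_eq => -[|[|[|k]]] // _; rewrite tcoefD tcoefZ.
  + by rewrite !jet_map0 tcoefD tcoefZ.
  + rewrite !jet_map1 tcoefD tcoefZ cE A0; ring.
  + rewrite !jet_map2 !tcoefD !tcoefZ !cE B0 A1; ring.
- split=> [s t /OtruncP-/(_ oV) hs /OtruncP-/(_ oV) ht x Vx|x Vx].
    have c0 : coefs (s \* t) 0 = coefs s 0 \* coefs t 0.
      by apply/funext => y; rewrite /coefs /= tcoefM0.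
    (* The factor 1 gives the sum the shape of the linearity clause of [is_hasse]. *)
    have c1 : coefs (s \* t) 1 =
        fun y => 1 * (coefs s 0 \* coefs t 1) y + (coefs s 1 \* coefs t 0) y.
      by apply/funext => y; rewrite /coefs /= tcoefM1 mul1r.
    have [A0 B0] := h4 _ _ (hs 0 isT) (ht 0 isT) x Vx.
    have [A01 _] := h4 _ _ (hs 0 isT) (ht 1 isT) x Vx.
    have [A10 _] := h4 _ _ (hs 1 isT) (ht 0 isT) x Vx.
    have [A1 _] := h3 1 _ _ (reg_mul oV (hs 0 isT) (ht 1 isT))
      (reg_mul oV (hs 1 isT) (ht 0 isT)) x Vx.
    apply: tcoef_eq => -[|[|[|k]]] // _.
    + by rewrite tcoefM0 !jet_map0 tcoefM0.
    + rewrite tcoefM1 !jet_map0 !jet_map1 tcoefM1 c0 A0 /coefs; ring.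
    + rewrite tcoefM2 !jet_map0 !jet_map1 !jet_map2 tcoefM1 tcoefM2 c0 c1 B0 A1 A01 A10 /coefs.
      ring.
  have [A1 B1] := hasse1 h oV VU Vx.
  have c0 : coefs (fun=> 1 : trunc 3) 0 = fun=> 1.
    by apply/funext => y; rewrite /coefs tcoef_one.
  (* The vanishing coefficient of t in 1 is written as -1 * 1 + 1, so that linearity shows that A
     kills it. *)
  have [A0 _] := h3 (-1) _ _ (reg_cst 1 oV) (reg_cst 1 oV) x Vx.
  have c1 : coefs (fun=> 1 : trunc 3) 1 = fun=> -1 * 1 + 1.
    by apply/funext => y; rewrite /coefs tcoef_one mulN1r addNr.
  apply: tcoef_eq => -[|[|[|k]]] // _; rewrite tcoef_one.
  + by rewrite jet_map0 tcoef_one.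
  + by rewrite jet_map1 tcoef_one c0 A1 mulr0 addr0.
  + rewrite jet_map2 !tcoef_one c0 B1 c1 A0 A1 /=; ring.
- exact: jet_map0.
Qed.

End Jets.

(** * Coefficients of an arbitrary endomorphism *)

Section Endos.
Variables (R : realType) (X : fspace R).
Local Notation C := R[i].
Local Notation trunc n := {poly %/ ('X^n : {poly C})}.
Implicit Types (U V : set X) (f g u v : X -> C) (A B : (X -> C) -> X -> C).

(** For k = 1, 2 these are the operators A, B of phi; [var_coef] gives its functions u, v. *)
Definition fun_coef n (phi : (X -> trunc n) -> X -> trunc n) k f : X -> C :=
  coefs (phi (fun y => tconst n (f y))) k.
Definition var_coef n (phi : (X -> trunc n) -> X -> trunc n) k : X -> C :=
  coefs (phi (fun=> tvar R n)) k.

Section Expand.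
Variables (U : set X) (phi : (X -> trunc 3) -> X -> trunc 3).
Hypothesis phiP : is_endo (Otrunc X 2) U phi.

Lemma fun_coef0 V f x : open V -> V `<=` U -> reg V f -> V x ->
  fun_coef phi 0 f x = f x.
Proof.
move=> oV VU hf Vx; have [_ _ _ _ p5] := phiP oV VU.
rewrite /fun_coef /coefs /tcoef p5 //; last exact: Otrunc_const.
by have := tcoef_const 3 (f x) 0; rewrite mulr1.
Qed.

Lemma var_coef0 x : open U -> U x -> var_coef phi 0 x = 0.
Proof.
move=> oU Ux; have [_ _ _ _ p5] := phiP oU (@subset_refl _ _).
rewrite /var_coef /coefs /tcoef p5 //; last exact: Otrunc_var.
exact: (tcoef_var R 1 0).
Qed.

(** The product rules are the coefficients of t and t^2 in phi (f g) = phi f * phi g, where the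
    constant terms are f and g because phi is the identity modulo t. *)
Lemma endo_hasse : is_hasse U (fun_coef phi 1) (fun_coef phi 2).
Proof.
move=> V oV VU; have [p1 p2 p3 [p4 _] p5] := phiP oV VU.
have cP f : reg V f -> Otrunc X 2 V (fun y => tconst 3 (f y)) by exact: Otrunc_const.
split=> [f hf|f g hf hg fg x Vx|a f g hf hg x Vx|f g hf hg x Vx].
- by split; exact: (p1 _ (cP f hf)).
- rewrite /fun_coef /coefs (p2 _ _ (cP f hf) (cP g hg)) //; last by rewrite inE.
  by move=> y Vy; rewrite fg.
- rewrite /fun_coef /coefs.
  have -> : (fun y => tconst 3 (a * f y + g y)) =
      (fun y => a *: tconst 3 (f y) + tconst 3 (g y)).
    by apply/funext => y; rewrite /tconst scalerDl scalerA.
  by rewrite p3 ?tcoefD ?tcoefZ //; exact: cP.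
- rewrite /fun_coef /coefs.
  have -> : (fun y => tconst 3 ((f \* g) y)) =
      (fun y => tconst 3 (f y)) \* (fun y => tconst 3 (g y)).
    apply/funext => y; apply: tcoef_eq => -[|[|[|k]]] // _ /=.
    + by rewrite tcoefM0 !tcoef_const /= !mulr1.
    + by rewrite tcoefM1 !tcoef_const /= !mulr0 !mul0r addr0.
    + by rewrite tcoefM2 !tcoef_const /= !mulr0 !mul0r !addr0.
  rewrite p4 ?tcoefM1 ?tcoefM2; [|exact: cP|exact: cP|by []].
  have e0 h : reg V h -> tcoef 0 (phi (fun y => tconst 3 (h y)) x) = h x.
    by move=> hh; exact: (fun_coef0 oV VU hh).
  by rewrite !e0 //; split; [rewrite [g x * _]mulrC|rewrite [g x * _]mulrC].
Qed.

(** phi is applied termwise to [trunc3_decomp]; each factor is a section, as the coefficients of a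
    section are regular. *)
Lemma endo_expand V s x : open V -> V `<=` U -> Otrunc X 2 V s -> V x ->
  phi s x = phi (fun y => tconst 3 (coefs s 0 y)) x
    + phi (fun y => tconst 3 (coefs s 1 y)) x * phi (fun=> tvar R 3) x
    + phi (fun y => tconst 3 (coefs s 2 y)) x
      * (phi (fun=> tvar R 3) x * phi (fun=> tvar R 3) x).
Proof.
move=> oV VU hs Vx; have [p1 p2 p3 [p4 _] _] := phiP oV VU.
have cP k : Otrunc X 2 V (fun y => tconst 3 (coefs s k y)).
  exact: (Otrunc_const _ oV (hs k)).
have vP := Otrunc_var 1 oV.
have v2P := asec_mul oV vP vP.
have c1P := asec_mul oV (cP 1) vP.
have c2P := asec_mul oV (cP 2) v2P.
have pD t r : Otrunc X 2 V t -> Otrunc X 2 V r ->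
    phi (fun y => 1 *: t y + r y) x = phi t x + phi r x.
  by move=> ht hr; rewrite p3 // scale1r.
rewrite -p4 // -p4 // -p4 // -pD // addrC -pD //; last first.
  exact: asec_lin.
congr (phi _ x); apply/funext => y; rewrite [LHS]trunc3_decomp !scale1r /= addrC.
by [].
Qed.

Lemma endo_coef0 V s x : open V -> V `<=` U -> Otrunc X 2 V s -> V x ->
  tcoef 0 (phi s x) = tcoef 0 (s x).
Proof. by move=> oV VU hs Vx; have [_ _ _ _ p5] := phiP oV VU; exact: p5. Qed.

(** As phi t = u t + v t^2 has no constant term, its square is u^2 t^2, and only the values of A and
    B on the two lowest coefficients survive. *)
Lemma endo_coef V s x : open U -> open V -> V `<=` U -> Otrunc X 2 V s -> V x ->
  tcoef 1 (phi s x) =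
    fun_coef phi 1 (coefs s 0) x + tcoef 1 (s x) * var_coef phi 1 x /\
  tcoef 2 (phi s x) = fun_coef phi 2 (coefs s 0) x
    + (fun_coef phi 1 (coefs s 1) x * var_coef phi 1 x
       + tcoef 1 (s x) * var_coef phi 2 x)
    + tcoef 2 (s x) * var_coef phi 1 x ^+ 2.
Proof.
move=> oU oV VU hs Vx; rewrite (endo_expand oV VU hs Vx).
have v0 := var_coef0 oU (VU _ Vx).
have f0 k := fun_coef0 (f := coefs s k) oV VU (hs k) Vx.
rewrite !tcoefD !tcoefM1 !tcoefM2 !tcoefM1 !tcoefM0.
move: v0 (f0 1) (f0 2); rewrite /var_coef /fun_coef /coefs => -> -> ->.
split; ring.
Qed.

End Expand.

Lemma aut_reg n U (phi : alg_aut (Otrunc X n.+1) U) V k : open U -> open V -> V `<=` U ->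
  reg V (var_coef phi k) /\ (forall f, reg V f -> reg V (fun_coef phi k f)).
Proof.
move=> oU oV VU; have [p1 _ _ _ _] := aut_endo phi oV VU.
split=> [|f hf]; first exact: (p1 _ (Otrunc_var n oV)).
exact: (p1 _ (Otrunc_const _ oV hf)).
Qed.

End Endos.

(** * Comparison of coefficients in theta g c_j = c_i gamma g *)

Section Conjugation.
Variables (R : realType) (X : fspace R).
Local Notation C := R[i].
Local Notation trunc n := {poly %/ ('X^n : {poly C})}.
Implicit Types (U V W : set X) (a b c f g u v : X -> C) (A B : (X -> C) -> X -> C).

Lemma hasse0 U V A B x : is_hasse U A B -> open V -> V `<=` U -> V x ->
  A (fun=> 0) x = 0 /\ B (fun=> 0) x = 0.
Proof.
move=> h oV VU Vx; have [_ _ h3 _] := h V oV VU.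
have [] := h3 (-1) _ _ (reg_cst 0 oV) (reg_cst 0 oV) x Vx.
have -> : (fun=> -1 * 0 + 0) = (fun=> 0 : C) :> (X -> C).
  by apply/funext => y; rewrite mulr0 addr0.
by rewrite !mulN1r !addNr.
Qed.

(** Lets a composite be computed one factor at a time, with the coefficients simplified in between.
    Their regularity is recorded because the operators of the next factor are applied to them. *)
Definition has_coefs V (s : X -> trunc 3) a b c :=
  [/\ Otrunc X 2 V s, reg V a, reg V b, reg V c & forall x, V x ->
      [/\ tcoef 0 (s x) = a x, tcoef 1 (s x) = b x & tcoef 2 (s x) = c x]].

Lemma has_coefs_ext V s a b c a' b' c' : has_coefs V s a b c ->
  (forall x, V x -> [/\ a x = a' x, b x = b' x & c x = c' x]) ->
  has_coefs V s a' b' c'.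
Proof.
move=> [hs ha hb hc hv] h; split=> //.
- by apply: reg_ext ha => x; rewrite inE => /h[].
- by apply: reg_ext hb => x; rewrite inE => /h[].
- by apply: reg_ext hc => x; rewrite inE => /h[].
- by move=> x Vx; have [<- <- <-] := h x Vx; exact: hv.
Qed.

Lemma has_coefs_const V f : open V -> reg V f ->
  has_coefs V (fun y => tconst 3 (f y)) f (fun=> 0) (fun=> 0).
Proof.
move=> oV hf; split=> [||||x _]; [exact: Otrunc_const|by []| | |]; try exact: reg_cst.
by rewrite !tcoef_const /= mulr1 !mulr0.
Qed.

Lemma has_coefs_var V : open V ->
  has_coefs V (fun=> tvar R 3) (fun=> 0) (fun=> 1) (fun=> 0).
Proof.
move=> oV; split=> [||||x _]; [exact: Otrunc_var| | | |]; try exact: reg_cst.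
by rewrite !tcoef_var.
Qed.

Lemma has_coefs_endo U V phi s a b c : open U -> open V -> V `<=` U ->
  is_endo (Otrunc X 2) U phi -> has_coefs V s a b c ->
  has_coefs V (phi s) a
    (fun x => fun_coef phi 1 a x + b x * var_coef phi 1 x)
    (fun x => fun_coef phi 2 a x
       + (fun_coef phi 1 b x * var_coef phi 1 x + b x * var_coef phi 2 x)
       + c x * var_coef phi 1 x ^+ 2).
Proof.
move=> oU oV VU hphi [hs ha hb hc hv].
have [p1 _ _ _ _] := hphi V oV VU.
have [h1 h2 h3 h4] := endo_hasse hphi oV VU.
have [Aa Ba] := h1 a ha; have [Ab Bb] := h1 b hb.
have vP k : reg V (var_coef phi k) by exact: (p1 _ (Otrunc_var 1 oV)).
split=> //; first exact: p1.
- exact: reg_add oV Aa (reg_mul oV hb (vP 1)).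
- apply: (reg_add oV (reg_add oV Ba (reg_add oV (reg_mul oV Ab (vP 1))
    (reg_mul oV hb (vP 2)))) (reg_mul oV hc (reg_exp 2 oV (vP 1)))).
- move=> x Vx; have [e0 e1 e2] := hv x Vx.
  rewrite (endo_coef0 hphi oV VU hs Vx).
  have [-> ->] := endo_coef hphi oU oV VU hs Vx.
  (* [a] and [b] agree with the coefficients of [s] on [V] only; the locality clause carries this
     through the operators. *)
  have sa : {in V, coefs s 0 =1 a} by move=> y; rewrite inE => /hv[].
  have sb : {in V, coefs s 1 =1 b} by move=> y; rewrite inE => /hv[].
  have [-> ->] := h2 _ _ (hs 0) ha sa x Vx.
  have [-> _] := h2 _ _ (hs 1) hb sb x Vx.
  by rewrite e0 e1 e2.
Qed.

Lemma has_coefs_unique V s t a b c a' b' c' x : V x ->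
  has_coefs V s a b c -> has_coefs V t a' b' c' -> s x = t x ->
  b x = b' x /\ c x = c' x.
Proof.
by move=> Vx [_ _ _ _ /(_ x Vx)[_ <- <-]] [_ _ _ _ /(_ x Vx)[_ <- <-]] ->.
Qed.

(** The relation is evaluated at t and at a function f. In degree 1 it shows that th lies in the
    kernel of G_3 -> G_2, using that nu is invertible; in degree 2 it then determines the two
    remaining coefficients of th. The formula for the image of t keeps a factor nu, so that no
    division occurs here. *)
Lemma conjugate_coefs W (ci gam g cj th : (X -> trunc 3) -> X -> trunc 3)
    (nu eta : X -> C) (eps : (X -> C) -> X -> C) :
  open W ->
  is_endo (Otrunc X 2) W ci -> is_endo (Otrunc X 2) W gam ->
  is_endo (Otrunc X 2) W g -> is_endo (Otrunc X 2) W cj ->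
  is_endo (Otrunc X 2) W th ->
  (forall V s, open V -> V `<=` W -> Otrunc X 2 V s -> forall x, V x ->
     th (g (cj s)) x = ci (gam (g s)) x) ->
  (forall V f x, open V -> V `<=` W -> reg V f -> V x ->
     fun_coef g 1 f x = 0 /\ fun_coef g 2 f x = 0) ->
  (forall x, W x -> var_coef g 1 x = nu x /\ var_coef g 2 x = 0) ->
  (forall V f x, open V -> V `<=` W -> reg V f -> V x ->
     fun_coef gam 1 f x = 0 /\ fun_coef gam 2 f x = eps f x) ->
  (forall x, W x -> var_coef gam 1 x = 1 /\ var_coef gam 2 x = eta x) ->
  (forall x, W x -> var_coef ci 1 x = 1 /\ var_coef cj 1 x = 1) ->
  (forall V f x, open V -> V `<=` W -> reg V f -> V x ->
     fun_coef ci 1 f x = fun_coef cj 1 f x * nu x) ->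
  reg W nu -> (forall x, W x -> nu x != 0) ->
  [/\ forall x, W x -> var_coef th 1 x = 1 /\
        nu x * var_coef th 2 x = nu x * eta x + fun_coef ci 1 nu x
          + nu x * var_coef ci 2 x - nu x ^+ 2 * var_coef cj 2 x &
      forall V f x, open V -> V `<=` W -> reg V f -> V x ->
        fun_coef th 1 f x = 0 /\
        fun_coef th 2 f x = eps f x + fun_coef ci 2 f x
          - nu x ^+ 2 * fun_coef cj 2 f x - fun_coef ci 1 f x * var_coef th 2 x].
Proof.
move=> oW hci hgam hg hcj hth H gf gv gamf gamv cv cD nuP nu0.
(* At t, with a_j = [var_coef cj 2]: th (nu t + nu^2 a_j t^2) = ci (nu t + nu eta t^2). *)
have var_step V (oV : open V) (VW : V `<=` W) x (Vx : V x) :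
  nu x = nu x * var_coef th 1 x /\
  fun_coef th 1 nu x * var_coef th 1 x + nu x * var_coef th 2 x
    + nu x ^+ 2 * var_coef cj 2 x * var_coef th 1 x ^+ 2
  = fun_coef ci 1 nu x + nu x * var_coef ci 2 x + nu x * eta x.
- have nuV : reg V nu by apply: reg_sub nuP.
  have VWx y : V y -> W y by exact: VW.
  have l0 := has_coefs_endo oW oV VW hcj (has_coefs_var oV).
  have l1 : has_coefs V (cj (fun=> tvar R 3)) (fun=> 0) (fun=> 1) (var_coef cj 2).
    apply: has_coefs_ext l0 _ => y Vy; have [z1 z2] := hasse0 (endo_hasse hcj) oV VW Vy.
    have [o1 _] := hasse1 (endo_hasse hcj) oV VW Vy.
    by have [_ e] := cv y (VW y Vy); split=> //; rewrite ?z1 ?z2 ?e ?o1; ring.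
  have l2 : has_coefs V (g (cj (fun=> tvar R 3))) (fun=> 0) nu
      (fun y => nu y ^+ 2 * var_coef cj 2 y).
    have [_ r0 r1 r2 _] := l1.
    apply: has_coefs_ext (has_coefs_endo oW oV VW hg l1) _ => y Vy.
    have [e1 e2] := gf V _ y oV VW r0 Vy; have [f1 _] := gf V _ y oV VW r1 Vy.
    by have [u1 u2] := gv y (VW y Vy); split=> //; rewrite ?e1 ?e2 ?f1 u1 ?u2; ring.
  have l3 := has_coefs_endo oW oV VW hth l2.
  have r1 : has_coefs V (g (fun=> tvar R 3)) (fun=> 0) nu (fun=> 0).
    apply: has_coefs_ext (has_coefs_endo oW oV VW hg (has_coefs_var oV)) _ => y Vy.
    have [e1 e2] := gf V _ y oV VW (reg_cst 0 oV) Vy.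
    have [f1 _] := gf V _ y oV VW (reg_cst 1 oV) Vy.
    by have [u1 u2] := gv y (VW y Vy); split=> //; rewrite ?e1 ?e2 ?f1 u1 ?u2; ring.
  have r2 : has_coefs V (gam (g (fun=> tvar R 3))) (fun=> 0) nu (fun y => nu y * eta y).
    apply: has_coefs_ext (has_coefs_endo oW oV VW hgam r1) _ => y Vy.
    have [z1 z2] := hasse0 (endo_hasse hgam) oV VW Vy.
    have [f1 _] := gamf V _ y oV VW nuV Vy.
    by have [u1 u2] := gamv y (VW y Vy); split=> //; rewrite ?z1 ?z2 ?f1 u1 ?u2; ring.
  have r3 := has_coefs_endo oW oV VW hci r2.
  have [] := has_coefs_unique Vx l3 r3 (H V _ oV VW (Otrunc_var 1 oV) x Vx).
  have [z1 z2] := hasse0 (endo_hasse hth) oV VW Vx.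
  have [y1 y2] := hasse0 (endo_hasse hci) oV VW Vx.
  have [u1 _] := cv x (VW x Vx).
  rewrite z1 z2 y1 y2 u1 !add0r expr1n !mulr1 => e1 e2.
  by split; [exact: esym e1|exact: e2].
(* At f, with D_i = nu D_j: th (f + D_i f t + nu^2 E_j f t^2) = ci (f + eps f t^2). *)
have fun_step V f (oV : open V) (VW : V `<=` W) x (Vx : V x) : reg V f ->
  fun_coef th 1 f x + fun_coef ci 1 f x * var_coef th 1 x = fun_coef ci 1 f x /\
  fun_coef th 2 f x + (fun_coef th 1 (fun_coef ci 1 f) x * var_coef th 1 x
     + fun_coef ci 1 f x * var_coef th 2 x)
     + nu x ^+ 2 * fun_coef cj 2 f x * var_coef th 1 x ^+ 2
  = fun_coef ci 2 f x + eps f x.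
- move=> fP.
  have l0 := has_coefs_endo oW oV VW hcj (has_coefs_const oV fP).
  have l1 : has_coefs V (cj (fun y => tconst 3 (f y))) f (fun_coef cj 1 f) (fun_coef cj 2 f).
    apply: has_coefs_ext l0 _ => y Vy; have [z1 z2] := hasse0 (endo_hasse hcj) oV VW Vy.
    by split=> //; rewrite ?z1; ring.
  have l2 : has_coefs V (g (cj (fun y => tconst 3 (f y)))) f (fun_coef ci 1 f)
      (fun y => nu y ^+ 2 * fun_coef cj 2 f y).
    have [_ r0 r1 r2 _] := l1.
    apply: has_coefs_ext (has_coefs_endo oW oV VW hg l1) _ => y Vy.
    have [e1 e2] := gf V _ y oV VW r0 Vy; have [f1 _] := gf V _ y oV VW r1 Vy.
    have [u1 u2] := gv y (VW y Vy); rewrite (cD V f y oV VW fP Vy).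
    by split=> //; rewrite ?e1 ?e2 ?f1 u1 ?u2; ring.
  have l3 := has_coefs_endo oW oV VW hth l2.
  have r1 : has_coefs V (g (fun y => tconst 3 (f y))) f (fun=> 0) (fun=> 0).
    apply: has_coefs_ext (has_coefs_endo oW oV VW hg (has_coefs_const oV fP)) _ => y Vy.
    have [e1 e2] := gf V _ y oV VW fP Vy.
    have [f1 _] := gf V _ y oV VW (reg_cst 0 oV) Vy.
    by have [u1 u2] := gv y (VW y Vy); split=> //; rewrite ?e1 ?e2 ?f1 u1 ?u2; ring.
  have r2 : has_coefs V (gam (g (fun y => tconst 3 (f y)))) f (fun=> 0) (eps f).
    apply: has_coefs_ext (has_coefs_endo oW oV VW hgam r1) _ => y Vy.
    have [z1 z2] := hasse0 (endo_hasse hgam) oV VW Vy.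
    have [f1 f2] := gamf V _ y oV VW fP Vy.
    by split=> //; rewrite ?f1 ?f2 ?z1; ring.
  have r3 := has_coefs_endo oW oV VW hci r2.
  have [] := has_coefs_unique Vx l3 r3 (H V _ oV VW (Otrunc_const _ oV fP) x Vx).
  have [y1 y2] := hasse0 (endo_hasse hci) oV VW Vx.
  have [u1 _] := cv x (VW x Vx).
  by rewrite y1 u1 !mul0r !addr0 expr1n mulr1.
have th1 x : W x -> var_coef th 1 x = 1.
  move=> Wx; have [e _] := var_step W oW (@subset_refl _ _) x Wx.
  by apply: (mulfI (nu0 x Wx)); rewrite mulr1.
have thf V f x : open V -> V `<=` W -> reg V f -> V x -> fun_coef th 1 f x = 0.
  move=> oV VW fP Vx; have [+ _] := fun_step V f oV VW x Vx fP.
  by rewrite th1 ?mulr1; [move/(canRL (addrK _)); rewrite subrr|exact: VW].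
split=> [x Wx|V f x oV VW fP Vx]; (split; first by [exact: th1|exact: thf Vx]).
- have [_ ] := var_step W oW (@subset_refl _ _) x Wx.
  rewrite (thf W nu x) // th1 // expr1n !mulr1 add0r => /(canRL (addrK _)) ->; ring.
- have [_ ] := fun_step V f oV VW x Vx fP.
  have [ciP _ _ _] := endo_hasse hci oV VW.
  have [ci1 _] := ciP f fP.
  (* The degree 1 operator of th also vanishes on the regular function D_i f, which removes the
     iterated term. *)
  rewrite (thf V (fun_coef ci 1 f) x) // th1; last exact: VW.
  rewrite expr1n !mulr1 add0r => /(canRL (addrK _))/(canRL (addrK _)) ->; ring.
Qed.

End Conjugation.

(** * Cech classes and cocycles *)

Section Cohomology.
Variables (C : fieldType) (X : topologicalType).
Implicit Types F G : vsheaf C X.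

Lemma H1class_eq F U s V t W (hU : covering U) (hs : cocycle (F := F) U s)
    (hV : covering V) (ht : cocycle V t) :
  covering W -> coboundary W (s - t) -> H1class hU hs = H1class hV ht.
Proof.
move=> hW st; apply/H1piP; rewrite /B1 /in_mem /=.
by apply/asboolP; exists W; split.
Qed.

Lemma represents_eq F U s V t W w w' : represents (F := F) U s w -> represents V t w' ->
  covering W -> coboundary W (s - t) -> w = w'.
Proof. by move=> [hU [hs ->]] [hV [ht ->]]; exact: H1class_eq. Qed.

(** The cocycle identity of [s'] follows from that of [s], so it never has to be checked on theta
    itself. *)
Lemma represents_cob F U s s' w : represents (F := F) U s w ->
  (forall x y, sec (U x `&` U y) (s' x y)) -> coboundary U (s' - s) ->
  represents U s' w.
Proof.
move=> [hU [hs ->]] hs' [t [t1 t2]].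
have oU x := proj1 (hU x).
have hc : cocycle U s'.
  have [_ s2] := hs; split=> // x y z.
  have o2 a b := openI (oU a) (oU b); have o3 := openI (o2 x y) (oU z).
  pose v a b := s' a b - s a b - (t a - t b).
  have vP a b : U x `&` U y `&` U z `<=` U a `&` U b ->
      van (U x `&` U y `&` U z) (v a b).
    by move=> h; apply: van_res h (t2 a b); [exact: o2|exact: o3].
  have vxy := vP x y (@subIsetl _ _ _).
  have vyz : van (U x `&` U y `&` U z) (v y z) by apply: vP => q [[? ?] ?].
  have vxz : van (U x `&` U y `&` U z) (v x z) by apply: vP => q [[? ?] ?].
  have := van_lin 1 o3 (van_lin (-1) o3 (van_lin 1 o3 vxy vyz) vxz) (s2 x y z).
  congr (van _ _); rewrite !scale1r scaleN1r.
  have E a b : s' a b = v a b + (s a b + (t a - t b)).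
    by rewrite /v [s a b + _]addrC addrA subrK subrK.
  rewrite !E.
  have -> : v x y + (s x y + (t x - t y)) + (v y z + (s y z + (t y - t z))) =
      (v x y + v y z) + ((s x y + s y z) + (t x - t z)).
    by rewrite addrACA [X in _ + X]addrACA [X in _ + (_ + X)]addrA subrK.
  by rewrite [in RHS]opprD [RHS]addrACA [s x y + s y z + _]addrC addrKA [- _ + _]addrC.
exists hU, hc; apply: (H1class_eq _ _ _ _ hU).
exists (- t); split=> [x|x y].
  have := sec_lin (-1) (oU x) (t1 x) (sec0 F (oU x)).
  by rewrite scaleN1r addr0.
have := van_lin (-1) (openI (oU x) (oU y)) (t2 x y) (van0 F (openI (oU x) (oU y))).
congr (van _ _); rewrite scaleN1r addr0.
have E a b : (s' - s) a b = s' a b - s a b by [].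
have E' a b : (s - s') a b = s a b - s' a b by [].
have E'' a : (- t) a = - t a by [].
by rewrite E E' !E'' [in RHS]opprD !opprK opprB opprB addrC.
Qed.

(** Cochains are encoded by global functions, so two encodings of the same cochain may differ; the
    zero 0-cochain shows that they are cohomologous. *)
Lemma coboundary_van F U (s t : X -> X -> carrier F) : covering U ->
  (forall x y, van (U x `&` U y) (s x y - t x y)) -> coboundary U (s - t).
Proof.
move=> hU st; exists 0; split=> [x|x y]; first exact: sec0 (hU x).1.
rewrite (_ : _ - _ = s x y - t x y) //.
by rewrite [X in _ - X](_ : _ = 0) ?subr0 //; exact: subrr.
Qed.

Lemma represents_lin F U a s t w w' :
  represents (F := F) U s w -> represents U t w' ->
  represents U (a *: s + t) (a *: w + w').
Proof.
move=> [hU [hs ->]] [hU' [ht ->]].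
exists hU, (cocycle_lin a hU hs ht).
rewrite [a *: _]H1piZ -H1piD; congr (H1pi _); exact: val_inj.
Qed.

Lemma represents_sub F U V s w : covering V -> (forall x, V x `<=` U x) ->
  represents (F := F) U s w -> represents V s w.
Proof.
move=> hV VU [hU [hs ->]]; exists hV, (cocycle_sub hU hV VU hs).
by congr (H1pi _); exact: val_inj.
Qed.

Lemma represents_repr F (w : H1 F) : exists U s, represents U s w.
Proof.
have /asboolP[U [hU hs]] := z1valP (repr w).
exists U, (z1val (repr w)), hU, hs; rewrite -[LHS]H1pi_repr.
by congr (H1pi _); exact: val_inj.
Qed.

(** [H1map] is computed on [repr w], which differs from [s] by a coboundary; phi maps this
    coboundary to a coboundary. *)
Lemma represents_map F G (phi : vsheaf_hom F G) U s w :
  represents U s w -> represents U (fun x y => phi (s x y)) (H1map phi w).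
Proof.
move=> [hU [hs e]]; have hc := hom_cocycle phi hU hs.
exists hU, hc; apply/H1piP; rewrite /B1 /in_mem /=.
have /H1piP : H1pi (repr w) = H1pi (MkZ1 (z1_of_cocycle hU hs)) by rewrite H1pi_repr e.
rewrite /B1 /in_mem /= => /asboolP[W [hW [t [t1 t2]]]].
apply/asboolP; exists W; split=> //; exists (fun x => phi (t x)); split=> [x|x y].
  by apply: hom_sec (t1 x); case: (hW x).
have pN u v : phi (u - v) = phi u - phi v.
  have := hom_lin phi (-1) v u; rewrite !scaleN1r => H.
  by rewrite [u - v]addrC H addrC.
have := hom_van phi (openI (hW x).1 (hW y).1) (t2 x y).
by rewrite pN pN pN.
Qed.

End Cohomology.

(** * Automorphisms with prescribed coefficients *)

Section Constructions.
Variables (R : realType) (X : fspace R).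
Local Notation C := R[i].
Local Notation trunc n := {poly %/ ('X^n : {poly C})}.
Implicit Types (U V W : set X) (f g u v : X -> C) (A B : (X -> C) -> X -> C).

(** Derivations of O_U into itself: the form that [is_derivation] takes after division by the power
    of a frame. *)
Definition is_der U A := forall V, open V -> V `<=` U ->
  [/\ forall f, reg V f -> reg V (A f),
      forall f g, reg V f -> reg V g -> {in V, f =1 g} -> forall x, V x -> A f x = A g x,
      forall a f g, reg V f -> reg V g -> forall x, V x ->
        A (fun y => a * f y + g y) x = a * A f x + A g x &
      forall f g, reg V f -> reg V g -> forall x, V x ->
        A (f \* g) x = f x * A g x + g x * A f x].

(** B and A^2 / 2 have the same defect A f * A g in the product rule, so it cancels in the
    difference; u A is a derivation already. *)
Lemma hasse_der U A B u : reg U u -> open U -> is_hasse U A B ->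
  is_der U (fun f x => B f x - 2%:R^-1 * A (A f) x - u x * A f x).
Proof.
move=> hu oU h V oV VU; have [h1 h2 h3 h4] := h V oV VU.
have uV : reg V u by apply: reg_sub hu.
have AP f : reg V f -> reg V (A f) by case/h1.
have BP f : reg V f -> reg V (B f) by case/h1.
split=> [f hf|f g hf hg fg x Vx|a f g hf hg x Vx|f g hf hg x Vx].
- have hA := AP _ hf; have hAA := AP _ hA.
  apply: reg_ext (reg_add oV (reg_add oV (BP _ hf) (reg_mul oV (reg_cst (- 2%:R^-1) oV) hAA))
    (reg_mul oV (reg_cst (-1) oV) (reg_mul oV uV hA))) => x _ /=.
  ring.
- have e y : V y -> A f y = A g y by move=> Vy; have [] := h2 f g hf hg fg y Vy.
  have e' : {in V, A f =1 A g} by move=> y; rewrite inE; exact: e.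
  have [-> _] := h2 _ _ (AP _ hf) (AP _ hg) e' x Vx.
  by have [-> ->] := h2 f g hf hg fg x Vx.
- have e : {in V, A (fun y => a * f y + g y) =1 (fun y => a * A f y + A g y)}.
    by move=> y; rewrite inE => Vy; have [] := h3 a f g hf hg y Vy.
  have r1 : reg V (fun y => a * f y + g y).
    by apply: (reg_add oV) => //; apply: (reg_mul oV (reg_cst a oV)).
  have r2 : reg V (fun y => a * A f y + A g y).
    by apply: (reg_add oV); [apply: (reg_mul oV (reg_cst a oV))|]; exact: AP.
  have [-> _] := h2 _ _ (AP _ r1) r2 e x Vx.
  have [-> _] := h3 a _ _ (AP _ hf) (AP _ hg) x Vx.
  have [-> ->] := h3 a f g hf hg x Vx.
  ring.
- have e : {in V, A (f \* g) =1 (fun y => 1 * (f \* A g) y + (g \* A f) y)}.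
    by move=> y; rewrite inE mul1r => Vy; have [] := h4 f g hf hg y Vy.
  have rA := AP _ (reg_mul oV hf hg).
  have r1 := reg_mul oV hf (AP _ hg); have r2 := reg_mul oV hg (AP _ hf).
  have r3 : reg V (fun y => 1 * (f \* A g) y + (g \* A f) y).
    by apply: (reg_add oV) => //; apply: (reg_mul oV (reg_cst 1 oV)).
  have [-> _] := h2 _ _ rA r3 e x Vx.
  have [-> _] := h3 1 _ _ r1 r2 x Vx.
  have [-> _] := h4 _ _ hf (AP _ hg) x Vx.
  have [-> _] := h4 _ _ hg (AP _ hf) x Vx.
  have [-> ->] := h4 _ _ hf hg x Vx.
  by field.
Qed.

(** These are the coefficients of exp (a t A) modulo t^3, the exponential of a derivation being
    multiplicative. The scalar a is kept free since the inverse is the case of the opposite sign. *)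
Lemma exp_hasse U A (a : C) : is_der U A ->
  is_hasse U (fun f x => a * A f x) (fun f x => 2%:R^-1 * a ^+ 2 * A (A f) x).
Proof.
move=> h V oV VU; have [AP h2 h3 h4] := h V oV VU.
split=> [f hf|f g hf hg fg x Vx|k f g hf hg x Vx|f g hf hg x Vx].
- split; first by apply: (reg_mul oV (reg_cst a oV)); exact: AP.
  exact: (reg_mul oV (reg_cst (2%:R^-1 * a ^+ 2) oV) (AP _ (AP _ hf))).
- rewrite (h2 f g) // (h2 (A f) (A g)) //; try exact: AP.
  by move=> y; rewrite inE; exact: h2.
- have e : {in V, A (fun y => k * f y + g y) =1 (fun y => k * A f y + A g y)}.
    by move=> y; rewrite inE; exact: h3.
  have r1 : reg V (fun y => k * f y + g y).
    by apply: (reg_add oV) => //; apply: (reg_mul oV (reg_cst k oV)).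
  have r2 : reg V (fun y => k * A f y + A g y).
    by apply: (reg_add oV); [apply: (reg_mul oV (reg_cst k oV))|]; exact: AP.
  rewrite (h2 _ _ (AP _ r1) r2 e x Vx) !h3 //; try exact: AP.
  by split; ring.
- have e : {in V, A (f \* g) =1 (fun y => 1 * (f \* A g) y + (g \* A f) y)}.
    by move=> y; rewrite inE mul1r; exact: h4.
  have rA := AP _ (reg_mul oV hf hg).
  have r1 := reg_mul oV hf (AP _ hg); have r2 := reg_mul oV hg (AP _ hf).
  have r3 : reg V (fun y => 1 * (f \* A g) y + (g \* A f) y).
    by apply: (reg_add oV) => //; apply: (reg_mul oV (reg_cst 1 oV)).
  rewrite (h2 _ _ rA r3 e x Vx) (h3 1 _ _ r1 r2 x Vx) !h4 //; try exact: AP.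
  by split; [ring|by field].
Qed.

Lemma der_hasse U A : is_der U A -> is_hasse U (fun _ _ => 0) A.
Proof.
move=> h V oV VU; have [AP h2 h3 h4] := h V oV VU.
split=> [f hf|f g hf hg fg x Vx|k f g hf hg x Vx|f g hf hg x Vx].
- by split; [exact: reg_cst|exact: AP].
- by rewrite (h2 f g).
- by rewrite h3 //= mulr0 addr0.
- by rewrite h4 //=; split; ring.
Qed.

Lemma hasse_der0 U A B : is_hasse U A B ->
  (forall V f x, open V -> V `<=` U -> reg V f -> V x -> A f x = 0) -> is_der U B.
Proof.
move=> h A0 V oV VU; have [h1 h2 h3 h4] := h V oV VU.
split=> [f /h1[]//|f g hf hg fg x Vx|k f g hf hg x Vx|f g hf hg x Vx].
- by have [] := h2 f g hf hg fg x Vx.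
- by have [] := h3 k f g hf hg x Vx.
- have [_ ->] := h4 f g hf hg x Vx.
  by rewrite (A0 V f x) // mul0r addr0.
Qed.

(** Only degrees 1 and 2 carry a condition: inducing the identity modulo t fixes the constant
    terms. *)
Lemma transitionP U nu (g : G3 U) : open U -> is_transition nu g <->
  (forall V f x, open V -> V `<=` U -> reg V f -> V x ->
     fun_coef g 1 f x = 0 /\ fun_coef g 2 f x = 0) /\
  (forall x, U x -> var_coef g 1 x = nu x /\ var_coef g 2 x = 0).
Proof.
move=> oU; split=> [[h1 h2]|[h1 h2]]; split.
- move=> V f x oV VU hf Vx.
  rewrite /fun_coef /coefs (h1 V f oV VU hf x Vx).
  by rewrite -[_%:A]/(tconst 3 (f x)) !tcoef_const !mulr0.
- move=> x Ux; rewrite /var_coef /coefs (h2 x Ux) -[qpolyX _]/(tvar R 3).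
  by rewrite !tcoefZ !tcoef_var mulr1 mulr0.
- move=> V f oV VU hf x Vx; have [e1 e2] := h1 V f x oV VU hf Vx.
  rewrite -[_%:A]/(tconst 3 (f x)).
  apply: tcoef_eq => -[|[|[|k]]] // _; rewrite tcoef_const.
  + by rewrite mulr1; exact: (fun_coef0 (aut_endo g) oV VU hf Vx).
  + by rewrite mulr0; exact: e1.
  + by rewrite mulr0; exact: e2.
- move=> x Ux; have [e1 e2] := h2 x Ux; rewrite -[qpolyX _]/(tvar R 3).
  apply: tcoef_eq => -[|[|[|k]]] // _; rewrite tcoefZ tcoef_var.
  + by rewrite mulr0; exact: (var_coef0 (aut_endo g) oU Ux).
  + by rewrite mulr1; exact: e1.
  + by rewrite mulr0; exact: e2.
Qed.

Lemma kernel_eltP U eta eps (g : G3 U) : open U -> is_kernel_elt eta eps g <->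
  (forall V f x, open V -> V `<=` U -> reg V f -> V x ->
     fun_coef g 1 f x = 0 /\ fun_coef g 2 f x = eps f x) /\
  (forall x, U x -> var_coef g 1 x = 1 /\ var_coef g 2 x = eta x).
Proof.
move=> oU; split=> [[h1 h2]|[h1 h2]]; split.
- move=> V f x oV VU hf Vx.
  rewrite /fun_coef /coefs (h1 V f oV VU hf x Vx).
  rewrite -[_%:A]/(tconst 3 (f x)) -[qpolyX _]/(tvar R 3) expr2.
  rewrite !tcoefD !tcoef_const !tcoefZ tcoefM1 tcoefM2 !tcoef_var /=.
  by split; ring.
- move=> x Ux; rewrite /var_coef /coefs (h2 x Ux) -[qpolyX _]/(tvar R 3).
  rewrite tcoefM1 tcoefM2 !tcoefD !tcoefZ !tcoef_one !tcoef_var /=.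
  by split; ring.
- move=> V f oV VU hf x Vx; have [e1 e2] := h1 V f x oV VU hf Vx.
  rewrite -[_%:A]/(tconst 3 (f x)) -[qpolyX _]/(tvar R 3) expr2.
  apply: tcoef_eq => -[|[|[|k]]] // _; rewrite tcoefD tcoef_const tcoefZ.
  + rewrite (fun_coef0 (aut_endo g) oV VU hf Vx : tcoef 0 _ = _).
    by rewrite tcoefM0 !tcoef_var /=; ring.
  + rewrite (e1 : tcoef 1 _ = _).
    by rewrite tcoefM1 !tcoef_var /=; ring.
  + rewrite (e2 : tcoef 2 _ = _).
    by rewrite tcoefM2 !tcoef_var /=; ring.
- move=> x Ux; have [e1 e2] := h2 x Ux; rewrite -[qpolyX _]/(tvar R 3).
  apply: tcoef_eq => -[|[|[|k]]] // _.
  + rewrite (var_coef0 (aut_endo g) oU Ux : tcoef 0 _ = _).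
    by rewrite tcoefM0 tcoef_var mulr0.
  + rewrite (e1 : tcoef 1 _ = _).
    by rewrite tcoefM1 !tcoefD !tcoefZ !tcoef_one !tcoef_var /=; ring.
  + rewrite (e2 : tcoef 2 _ = _).
    by rewrite tcoefM2 !tcoefD !tcoefZ !tcoef_one !tcoef_var /=; ring.
Qed.

Lemma coefs_const n f : coefs (fun y => tconst n (f y)) 0 = f.
Proof. by apply/funext => y; rewrite /coefs tcoef_const mulr1. Qed.

Lemma coefs_constS n f k : coefs (fun y => tconst n (f y)) k.+1 = fun=> 0.
Proof. by apply/funext => y; rewrite /coefs tcoef_const mulr0. Qed.

Lemma coefs_var n k : coefs (fun _ : X => tvar R n.+2) k = fun=> (k == 1)%:R.
Proof. by apply/funext => y; rewrite /coefs tcoef_var. Qed.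

Lemma jet_map_fun U V A B u v f x : is_hasse U A B -> open V -> V `<=` U -> V x ->
  fun_coef (jet_map A B u v) 1 f x = A f x /\
  fun_coef (jet_map A B u v) 2 f x = B f x.
Proof.
move=> h oV VU Vx; have [z _] := hasse0 h oV VU Vx.
rewrite /fun_coef {1 2}/coefs jet_map1 jet_map2 !tcoef_const coefs_const coefs_constS z /=.
by split; ring.
Qed.

Lemma jet_map_var U V A B u v x : is_hasse U A B -> open V -> V `<=` U -> V x ->
  var_coef (jet_map A B u v) 1 x = u x /\
  var_coef (jet_map A B u v) 2 x = v x.
Proof.
move=> h oV VU Vx; have [z1 z2] := hasse0 h oV VU Vx.
have [o1 _] := hasse1 h oV VU Vx.
rewrite /var_coef {1 2}/coefs jet_map1 jet_map2 !tcoef_var !coefs_var z1 z2 o1 /=.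
by split; ring.
Qed.

Lemma transition_exists U nu : open U -> reg U nu -> reg U (fun x => (nu x)^-1) ->
  (forall x, U x -> nu x != 0) -> exists g : G3 U, is_transition nu g.
Proof.
move=> oU nuP nuVP nu0.
have h0 : is_hasse U (fun _ _ => 0) (fun _ _ => 0).
  apply: der_hasse => V oV VU.
  by split=> *; rewrite ?mulr0 ?addr0 //; exact: reg_cst.
(* Scalings of t by mutually inverse functions cancel; this serves for both orders of nu and its
   inverse. *)
have hc V (s : X -> trunc 3) (m m' : X -> C) : V `<=` U -> Otrunc X 2 V s ->
    (forall x, V x -> m x * m' x = 1) ->
    {in V, jet_map (fun _ _ => 0) (fun _ _ => 0) m (fun=> 0)
      (jet_map (fun _ _ => 0) (fun _ _ => 0) m' (fun=> 0) s) =1 s}.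
  move=> VU hs hm x; rewrite inE => Vx.
  apply: tcoef_eq => -[|[|[|k]]] // _.
  + by rewrite !jet_map0.
  + by rewrite !jet_map1 !add0r mulrA hm // mul1r.
  + rewrite !jet_map2 !mul0r !mulr0 !addr0 !add0r mulrA -exprMn hm //.
    by rewrite expr1n mul1r.
have h1 := jet_map_endo oU h0 nuP (reg_cst 0 oU).
have h2 := jet_map_endo oU h0 nuVP (reg_cst 0 oU).
have hcan V s : open V -> V `<=` U -> Otrunc X 2 V s ->
    {in V, jet_map (fun _ _ => 0) (fun _ _ => 0) (fun x => (nu x)^-1) (fun=> 0)
      (jet_map (fun _ _ => 0) (fun _ _ => 0) nu (fun=> 0) s) =1 s} /\
    {in V, jet_map (fun _ _ => 0) (fun _ _ => 0) nu (fun=> 0)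
      (jet_map (fun _ _ => 0) (fun _ _ => 0) (fun x => (nu x)^-1) (fun=> 0) s) =1 s}.
  move=> oV VU hs; split; apply: hc => // x Vx.
    by rewrite mulVf //; exact/nu0/VU.
  by rewrite mulfV //; exact/nu0/VU.
exists (AlgAut h1 h2 hcan); apply/transitionP => //; split=> [V f x oV VU hf Vx|x Ux] /=.
  exact: (jet_map_fun _ _ f h0 oV VU Vx).
exact: (jet_map_var nu (fun=> 0) h0 oU (@subset_refl _ _) Ux).
Qed.

(** In the kernel of G_3 -> G_2 composition adds the coefficients of t^2, so the inverse has the
    opposite eta and eps. *)
Lemma kernel_elt_exists U eta eps : open U -> reg U eta -> is_der U eps ->
  exists g : G3 U, is_kernel_elt eta eps g.
Proof.
move=> oU etaP epsP; have h0 := der_hasse epsP.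
have h0' : is_hasse U (fun _ _ => 0) (fun f x => - eps f x).
  apply: der_hasse => V oV VU; have [d1 d2 d3 d4] := epsP V oV VU.
  split=> [f hf|f g hf hg fg x Vx|a f g hf hg x Vx|f g hf hg x Vx].
  - apply: reg_ext (reg_mul oV (reg_cst (-1) oV) (d1 f hf)) => x _ /=; exact: mulN1r.
  - by rewrite (d2 f g).
  - by rewrite d3 //; ring.
  - by rewrite d4 //; ring.
have r1 := reg_cst 1 oU.
have etaP' : reg U (fun x => - eta x).
  apply: reg_ext (reg_mul oU (reg_cst (-1) oU) etaP) => x _ /=; exact: mulN1r.
have h1 := jet_map_endo oU h0 r1 etaP; have h2 := jet_map_endo oU h0' r1 etaP'.
have hc (B B' : (X -> C) -> X -> C) (m m' : X -> C) (s : X -> trunc 3) :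
    (forall f x, B f x + B' f x = 0) -> (forall x, m x + m' x = 0) ->
    jet_map (fun _ _ => 0) B (fun=> 1) m
      (jet_map (fun _ _ => 0) B' (fun=> 1) m' s) =1 s.
  move=> hB hm x.
  have c0 : coefs (jet_map (fun _ _ => 0) B' (fun=> 1) m' s) 0 = coefs s 0.
    by apply/funext => y; rewrite /coefs jet_map0.
  apply: tcoef_eq => -[|[|[|k]]] // _.
  + by rewrite !jet_map0.
  + by rewrite !jet_map1 !add0r !mul1r.
  + rewrite jet_map2 jet_map1 jet_map2 c0.
    have -> : B (coefs s 0) x = - B' (coefs s 0) x by apply/eqP; rewrite -addr_eq0 hB.
    have -> : m x = - m' x by apply/eqP; rewrite -addr_eq0 hm.
    ring.
have hcan V s : open V -> V `<=` U -> Otrunc X 2 V s ->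
    {in V, jet_map (fun _ _ => 0) (fun f x => - eps f x) (fun=> 1) (fun x => - eta x)
      (jet_map (fun _ _ => 0) eps (fun=> 1) eta s) =1 s} /\
    {in V, jet_map (fun _ _ => 0) eps (fun=> 1) eta
      (jet_map (fun _ _ => 0) (fun f x => - eps f x) (fun=> 1) (fun x => - eta x) s) =1 s}.
  by move=> _ _ _; split=> x _; apply: hc => *; rewrite ?addNr ?addrN.
exists (AlgAut h1 h2 hcan); apply/kernel_eltP => //; split=> [V f x oV VU hf Vx|x Ux] /=.
  exact: (jet_map_fun _ _ f h0 oV VU Vx).
exact: (jet_map_var (fun=> 1) eta h0 oU (@subset_refl _ _) Ux).
Qed.

(* f |-> f + A f t, t |-> t *)
Definition jet2_map A (s : X -> trunc 2) : X -> trunc 2 := fun x =>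
  jet 1 (fun k => match k with
    | 0 => tcoef 0 (s x)
    | _ => A (coefs s 0) x + tcoef 1 (s x)
    end).

Lemma jet2_map0 A s x : tcoef 0 (jet2_map A s x) = tcoef 0 (s x).
Proof. by rewrite tcoef_jet. Qed.

Lemma jet2_map1 A s x : tcoef 1 (jet2_map A s x) = A (coefs s 0) x + tcoef 1 (s x).
Proof. by rewrite tcoef_jet. Qed.

Lemma jet2_map_endo U A : is_der U A -> is_endo (Otrunc X 1) U (jet2_map A).
Proof.
move=> h V oV VU; have [h1 h2 h3 h4] := h V oV VU.
split=> [s hs|s t hs ht st x|a s t hs ht x Vx||s hs x Vx].
- apply/OtruncP => // -[|[|k]] // _.
  + by apply: reg_ext (hs 0) => x _; rewrite /coefs jet2_map0.
  + by apply: reg_ext (reg_add oV (h1 _ (hs 0)) (hs 1)) => x _; rewrite /coefs jet2_map1.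
- rewrite inE => Vx; have stx : s x = t x by apply: st; rewrite inE.
  have st0 : {in V, coefs s 0 =1 coefs t 0} by move=> y Vy; rewrite /coefs st.
  apply: tcoef_eq => -[|[|k]] // _.
  + by rewrite !jet2_map0 stx.
  + by rewrite !jet2_map1 stx (h2 _ _ (hs 0) (ht 0) st0 x Vx).
- have cE : coefs (fun y => a *: s y + t y) 0 = fun y => a * coefs s 0 y + coefs t 0 y.
    by apply/funext => y; rewrite /coefs tcoefD tcoefZ.
  apply: tcoef_eq => -[|[|k]] // _; rewrite tcoefD tcoefZ.
  + by rewrite !jet2_map0 tcoefD tcoefZ.
  + rewrite !jet2_map1 tcoefD tcoefZ cE (h3 a _ _ (hs 0) (ht 0) x Vx); ring.
- split=> [s t hs ht x Vx|x Vx].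
    have c0 : coefs (s \* t) 0 = coefs s 0 \* coefs t 0.
      by apply/funext => y; rewrite /coefs /= tcoefM0.
    apply: tcoef_eq => -[|[|k]] // _.
    + by rewrite tcoefM0 !jet2_map0 tcoefM0.
    + rewrite tcoefM1 !jet2_map0 !jet2_map1 tcoefM1 c0.
      rewrite (h4 (coefs s 0) (coefs t 0) (hs 0) (ht 0) x Vx) /coefs; ring.
  have [_ o1] := hasse1 (der_hasse h) oV VU Vx.
  have c0 : coefs (fun _ : X => 1 : trunc 2) 0 = fun=> 1.
    by apply/funext => y; rewrite /coefs tcoef_one.
  apply: tcoef_eq => -[|[|k]] // _; rewrite tcoef_one.
  + by rewrite jet2_map0 tcoef_one.
  + by rewrite jet2_map1 tcoef_one c0 o1 addr0.
- exact: jet2_map0.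
Qed.

Lemma tcoef_reduce (s : X -> trunc 3) x k : (k < 2)%N ->
  tcoef k (reduce s x) = tcoef k (s x).
Proof. by move=> k2; rewrite tcoef_in k2. Qed.

Lemma derN U A : is_der U A -> is_der U (fun f x => -1 * A f x).
Proof.
move=> h V oV VU; have [h1 h2 h3 h4] := h V oV VU.
split=> [f hf|f g hf hg fg x Vx|a f g hf hg x Vx|f g hf hg x Vx].
- by apply: (reg_mul oV (reg_cst (-1) oV)); exact: h1.
- by rewrite (h2 f g).
- by rewrite h3 //; ring.
- by rewrite h4 //; ring.
Qed.

(* The lift is exp (t A) : f |-> f + A f t + A (A f) t^2 / 2, t |-> t, with inverse
   exp (- t A). *)
Lemma exp_exists U A : open U -> is_der U A ->
  exists (c : G3 U) (phi : G2 U), is_lift c phi /\ aut_fun phi = jet2_map A.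
Proof.
move=> oU hA; have r1 := reg_cst 1 oU; have r0 := reg_cst 0 oU.
pose E (a : C) (s : X -> trunc 3) := jet_map (fun f x => a * A f x)
  (fun f x => 2%:R^-1 * a ^+ 2 * A (A f) x) (fun=> 1) (fun=> 0) s.
have hE a : is_endo (Otrunc X 2) U (E a).
  exact: jet_map_endo oU (exp_hasse a hA) r1 r0.
have hc V a b s : a + b = 0 -> a ^+ 2 = b ^+ 2 -> open V -> V `<=` U -> Otrunc X 2 V s ->
    {in V, E a (E b s) =1 s}.
  move=> ab a2 oV VU hs x; rewrite inE => Vx; have [h1 h2 h3 h4] := hA V oV VU.
  have -> : a = - b by apply/eqP; rewrite -addr_eq0 ab.
  have c0 : coefs (E b s) 0 = coefs s 0 by apply/funext => y; rewrite /coefs jet_map0.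
  have c1 : coefs (E b s) 1 = fun y => b * A (coefs s 0) y + coefs s 1 y.
    by apply/funext => y; rewrite /coefs jet_map1 mul1r.
  have e := h3 b _ _ (h1 _ (hs 0)) (hs 1) x Vx.
  apply: tcoef_eq => -[|[|[|k]]] // _; rewrite /E.
  + by rewrite !jet_map0.
  + by rewrite !jet_map1 -/(E b s) c0; ring.
  + rewrite jet_map2 -/(E b s) c0 c1 e /E jet_map1 jet_map2; by field.
have sq : (-1 : C) ^+ 2 = 1 ^+ 2 by rewrite sqrrN.
have h3 V s : open V -> V `<=` U -> Otrunc X 2 V s ->
    {in V, E (-1) (E 1 s) =1 s} /\ {in V, E 1 (E (-1) s) =1 s}.
  by move=> oV VU hs; split; apply: hc; rewrite ?addNr ?addrN.
have h2 V s : open V -> V `<=` U -> Otrunc X 1 V s ->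
    {in V, jet2_map (fun f x => -1 * A f x) (jet2_map A s) =1 s} /\
    {in V, jet2_map A (jet2_map (fun f x => -1 * A f x) s) =1 s}.
  move=> oV VU hs; have c0 B : coefs (jet2_map B s) 0 = coefs s 0.
    by apply/funext => y; rewrite /coefs jet2_map0.
  by split=> x _; apply: tcoef_eq => -[|[|k]] // _; rewrite ?jet2_map0 // !jet2_map1 c0; ring.
exists (AlgAut (hE 1) (hE (-1)) h3).
exists (AlgAut (jet2_map_endo hA) (jet2_map_endo (derN hA)) h2); split=> //.
move=> V s oV VU hs x Vx /=; apply: tcoef_eq => -[|[|k]] // _; rewrite tcoef_reduce //.
- by rewrite jet_map0 jet2_map0 tcoef_reduce.
- rewrite jet_map1 jet2_map1 tcoef_reduce // !mul1r; congr (A _ x + _).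
  by apply/funext => y; rewrite /coefs tcoef_reduce.
Qed.

End Constructions.

(** * Frames, derivations and local expressions *)

Section Geometry.
Variables (R : realType) (X : fspace R) (L : line_bundle X).
Local Notation C := R[i].
Local Notation trunc n := {poly %/ ('X^n : {poly C})}.
Implicit Types (U V W : set X) (f g : X -> C) (A B : (X -> C) -> X -> C).

Lemma derivation_ext b U A B : is_derivation L b U A ->
  (forall V f x, open V -> V `<=` U -> reg V f -> V x -> B f x = A f x) ->
  is_derivation L b U B.
Proof.
move=> hA AB V oV VU; have [h1 h2 h3 h4] := hA V oV VU.
split=> [f hf|f g hf hg fg x Vx|a f g hf hg x Vx|f g hf hg x Vx].
- by apply: lpow_ext (h1 f hf) => // x; rewrite inE => Vx; rewrite (AB V).
- have Vx' : V x by rewrite inE in Vx.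
  by rewrite !(AB V) //; exact: h2.
- rewrite !(AB V) //; first exact: h3.
  by apply: (reg_add oV) => //; apply: (reg_mul oV (reg_cst a oV)).
- rewrite !(AB V) //; first exact: h4.
  exact: reg_mul.
Qed.

Lemma frame_lpow b U V e f : open V -> V `<=` U -> is_frame (lsec L) U e -> reg V f ->
  lpow L b V (fun x => f x * e x ^+ b).
Proof.
move=> oV VU he hf x Vx; exists V, e; split=> //; first exact: is_frame_sub he.
apply: reg_ext hf => y; rewrite inE => Vy.
by rewrite mulfK // expf_neq0 //; apply: he.1; exact: VU.
Qed.

Lemma frame_derivation b U e A : open U -> is_frame (lsec L) U e -> is_der U A ->
  is_derivation L b U (fun f x => A f x * e x ^+ b).
Proof.
move=> oU he hA V oV VU; have [h1 h2 h3 h4] := hA V oV VU.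
split=> [f hf|f g hf hg fg x Vx|a f g hf hg x Vx|f g hf hg x Vx].
- exact: frame_lpow VU he (h1 f hf).
- by rewrite (h2 f g) //; rewrite inE in Vx.
- by rewrite h3 // mulrDl mulrA.
- by rewrite h4 // mulrDl !mulrA.
Qed.

Lemma derivation_frame b U e A : open U -> is_frame (lsec L) U e ->
  is_derivation L b U A -> is_der U (fun f x => A f x / e x ^+ b).
Proof.
move=> oU he hA V oV VU; have [h1 h2 h3 h4] := hA V oV VU.
split=> [f hf|f g hf hg fg x Vx|a f g hf hg x Vx|f g hf hg x Vx].
- have := lpow_frame oV oU (h1 f hf) he.
  by rewrite (_ : V `&` U = V) //; apply/setIidPl.
- by rewrite (h2 f g) // inE.
- by rewrite h3 // mulrDl mulrA.
- by rewrite h4 // mulrDl !mulrA.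
Qed.

(** The Leibniz rule in logarithmic form, which turns multiplicative relations between frames into
    additive relations between cochains. *)
Lemma point_derivation_dlog V x (v : (X -> C) -> C) f g : open V -> V x -> point_derivation x v ->
  reg V f -> reg V g -> f x != 0 -> g x != 0 ->
  v (f \* g) / (f x * g x) = v f / f x + v g / g x.
Proof.
move=> oV Vx hv hf hg f0 g0; have [_ _ ->] := hv V oV Vx => //.
by field; rewrite f0 g0.
Qed.

(* Changing the frames from e to e' changes d nu / nu by the coboundary of
   d log (e' / e). *)
Lemma represents_nabla0 (U : X -> set X) (e : X -> X -> C) : trivialization L U e ->
  represents (F := Omega X) U (dlog (transition e)) (nabla0 L).
Proof.
move=> he; exists he.1, (dlog_cocycle he).
have [hF hf] := frame_trivialization L; have [hU heP] := he.
have hW := coveringI hF hU.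
apply: (H1class_eq _ _ _ _ hW).
pose r x : X -> C := fun p => e x p / frame L x p.
exists (fun x p v => v (r x) / r x p).
have nf x p : frame_dom L x p -> frame L x p != 0 by exact: (hf x).1.
have ne x p : U x p -> e x p != 0 by exact: (heP x).1.
split=> [x p [Fp Up]|x y p v [[Fx Ux] [Fy Uy]] hv].
  have [oW _] := hW x.
  exists (frame_dom L x `&` U x), 1, (fun _ q => frame L x q / e x q), (fun _ => r x).
  split=> //.
    move=> _; split; last exact: (frame_ratio (hF x).1 (hU x).1 (hf x) (heP x)).
    rewrite setIC; exact: (frame_ratio (hU x).1 (hF x).1 (heP x) (hf x)).
  by move=> q w _ _; rewrite big_ord1 /r mulrC invf_div.
pose W : set X := (frame_dom L x `&` U x) `&` (frame_dom L y `&` U y).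
have oW : open W by apply: openI; [exact: (hW x).1|exact: (hW y).1].
have Wp : W p by [].
have tf : reg W (transition (frame L) x y).
  by apply: reg_sub (frame_ratio (hF x).1 (hF y).1 (hf x) (hf y)) => //;
    [exact: openI (hF x).1 (hF y).1|move=> q [[? ?] [? ?]]].
have te : reg W (transition e x y).
  by apply: reg_sub (frame_ratio (hU x).1 (hU y).1 (heP x) (heP y)) => //;
    [exact: openI (hU x).1 (hU y).1|move=> q [[? ?] [? ?]]].
have rx : reg W (r x).
  by apply: reg_sub (frame_ratio (hF x).1 (hU x).1 (hf x) (heP x)) => //;
    [exact: openI (hF x).1 (hU x).1|move=> q [[? ?] [? ?]]].
have ry : reg W (r y).
  by apply: reg_sub (frame_ratio (hF y).1 (hU y).1 (hf y) (heP y)) => //;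
    [exact: openI (hF y).1 (hU y).1|move=> q [[? ?] [? ?]]].
have n0 q : W q -> [/\ transition (frame L) x y q != 0, transition e x y q != 0,
    r x q != 0 & r y q != 0].
  move=> [[Fxq Uxq] [Fyq Uyq]].
  by split; rewrite mulf_neq0 ?invr_neq0 ?nf ?ne.
(* Both sides are [e y / frame L x]; their logarithmic derivatives give the coboundary relation. *)
have e1 : {in W, transition (frame L) x y \* r y =1 transition e x y \* r x}.
  move=> q; rewrite inE => -[[Fxq Uxq] [Fyq Uyq]] /=; rewrite /transition /r.
  by field; rewrite !nf ?ne.
have [h1 _ _] := hv W oW Wp.
have e2 := h1 _ _ (reg_mul oW tf ry) (reg_mul oW te rx) e1.
have e3 : transition (frame L) x y p * r y p = transition e x y p * r x p.
  by apply: e1; rewrite inE.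
have [m1 m2 m3 m4] := n0 p Wp.
have d1 := point_derivation_dlog oW Wp hv tf ry m1 m4.
have d2 := point_derivation_dlog oW Wp hv te rx m2 m3.
rewrite e2 e3 d2 in d1.
have -> : (((dlog (transition (frame L)) - dlog (transition e)) x y : X -> ((X -> C) -> C) -> C^o)
   - ((fun p v => v (r x) / r x p) - (fun p v => v (r y) / r y p) : X -> ((X -> C) -> C) -> C^o)) p v
  = (v (transition (frame L) x y) / transition (frame L) x y p
     - v (transition e x y) / transition e x y p)
     - (v (r x) / r x p - v (r y) / r y p) by [].
move: d1.
move: (v (transition (frame L) x y) / _) (v (transition e x y) / _) (v (r x) / _) (v (r y) / _).
move=> a b c' d' h; have -> : a = b + c' - d' by rewrite h addrK.
ring.
Qed.

(** The two inverses at the right end of theta cancel. Since they cancel on [V] only, the equality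
    is passed through each outer factor by locality. *)
Lemma theta_comp (U : X -> set X) (c : forall x, G3 (U x)) (gam g : forall x y, G3 (U x `&` U y))
    x y V s p : (forall x, open (U x)) -> open V -> V `<=` U x `&` U y ->
  Otrunc X 2 V s -> V p ->
  theta c gam g x y (g x y (c y s)) p = c x (gam x y (g x y s)) p.
Proof.
move=> oU oV VU hs Vp; have VUy : V `<=` U y by move=> q /VU[].
have VUx : V `<=` U x by move=> q /VU[].
rewrite /theta /=.
have [c1 c2 _ _ _] := aut_endo (c y) oV VUy.
have [i1 i2 _ _ _] := aut_invendo (c y) oV VUy.
have [g1 g2 _ _ _] := aut_endo (g x y) oV VU.
have [j1 j2 _ _ _] := aut_invendo (g x y) oV VU.
have [k1 k2 _ _ _] := aut_endo (gam x y) oV VU.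
have [l1 l2 _ _ _] := aut_endo (c x) oV VUx.
have [can1 _] := aut_cancel (g x y) oV VU (c1 s hs).
have [can2 _] := aut_cancel (c y) oV VUy hs.
have P1 : Otrunc X 2 V (aut_invfun (g x y) (g x y (c y s))) by exact/j1/g1/c1.
have e1 := i2 _ _ P1 (c1 s hs) can1.
have e2 q : q \in V -> aut_invfun (c y) (aut_invfun (g x y) (g x y (c y s))) q = s q.
  by move=> Vq; rewrite e1 // can2.
have P2 := i1 _ P1.
have e3 := g2 _ _ P2 hs e2.
have e4 := k2 _ _ (g1 _ P2) (g1 _ hs) e3.
have e5 := l2 _ _ (k1 _ (g1 _ P2)) (k1 _ (g1 _ hs)) e4.
by apply: e5; rewrite inE.
Qed.

Lemma tcoef_trivialize (e : X -> C) (s : X -> trunc 2) x :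
  tcoef 0 (trivialize e s x) = tcoef 0 (s x) /\
  tcoef 1 (trivialize e s x) = tcoef 1 (s x) * e x.
Proof.
rewrite /trivialize -[_%:A]/(tconst 2 (tcoef 0 (s x))) -[qpolyX _]/(tvar R 2).
rewrite !tcoefD !tcoef_const !tcoefZ !tcoef_var -[(s x)`_1]/(tcoef 1 (s x)) /=.
by split; ring.
Qed.

(** The trivialization sends t to e t, hence the division by e on functions; t has coefficient 1
    because chi fixes the ideal L, and e t in particular. A lift has the same coefficients modulo
    t^2. *)
Lemma lift_coefs (chi : Aut02 L) U e (phi : G2 U) (c : G3 U) : open U ->
  is_frame (lsec L) U e -> local_expression chi e phi -> is_lift c phi ->
  (forall V f p, open V -> V `<=` U -> reg V f -> V p ->
     fun_coef c 1 f p = derivation_fun chi f p / e p) /\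
  (forall p, U p -> var_coef c 1 p = 1).
Proof.
move=> oU [e0 eP] hphi hc; split=> [V f p oV VU hf Vp|p Up].
- have hr : reduce (fun y => tconst 3 (f y)) = (fun y => tconst 2 (f y)).
    apply/funext => y; apply: tcoef_eq => k k2.
    by rewrite tcoef_reduce // !tcoef_const.
  have ht : trivialize e (fun y => tconst 2 (f y)) = (fun y => tconst 2 (f y)).
    apply/funext => y; have [t0 t1] := tcoef_trivialize e (fun y => tconst 2 (f y)) y.
    by apply: tcoef_eq => -[|[|k]] // _; rewrite ?t0 ?t1 !tcoef_const ?mulr0 ?mul0r.
  rewrite /fun_coef /coefs -tcoef_reduce // (hc V) //; last exact: Otrunc_const.
  rewrite hr; have := hphi V _ oV VU (Otrunc_const 1 oV hf) p Vp.
  rewrite ht => h; have [_] := tcoef_trivialize e (phi (fun y => tconst 2 (f y))) p.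
  rewrite -h => h'; apply: (mulIf (e0 p (VU p Vp))); rewrite divfK ?e0 //; last exact: VU.
- have hr : reduce (fun _ : X => tvar R 3) = (fun _ : X => tvar R 2).
    apply/funext => y; apply: tcoef_eq => k k2.
    by rewrite tcoef_reduce // !tcoef_var.
  have ht : trivialize e (fun _ : X => tvar R 2) = (fun y => e y *: 'qX).
    apply/funext => y; have [t0 t1] := tcoef_trivialize e (fun _ : X => tvar R 2) y.
    rewrite -[qpolyX _]/(tvar R 2).
    apply: tcoef_eq => -[|[|k]] // _; rewrite tcoefZ !tcoef_var.
      by rewrite t0 tcoef_var mulr0.
    by rewrite t1 tcoef_var mulrC.
  have UU : U `<=` U by [].
  rewrite /var_coef /coefs -tcoef_reduce // (hc U) //; last exact: Otrunc_var.
  rewrite hr; have := hphi U _ oU UU (Otrunc_var 0 oU) p Up.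
  (* The frame is itself a section of L, its coordinate being 1. *)
  have le : lsec L U e.
    apply/eP => //; apply: reg_ext (reg_cst 1 oU) => q; rewrite inE => Uq.
    by rewrite divff // e0.
  rewrite ht (aut02P chi oU le) ?inE // => h.
  have [_] := tcoef_trivialize e (phi (fun _ : X => tvar R 2)) p.
  rewrite -h -[qpolyX _]/(tvar R 2) tcoefZ tcoef_var mulr1 => h'.
  by apply: (mulIf (e0 p Up)); rewrite -h' mul1r.
Qed.

End Geometry.

(** * The action of Aut_0(X_2) *)

Section Action.
Variables (R : realType) (X : fspace R) (L : line_bundle X) (chi : Aut02 L).
Local Notation C := R[i].
Local Notation trunc n := {poly %/ ('X^n : {poly C})}.
Local Notation D := (derivation_fun chi).

Section Theta.
Variables (U : X -> set X) (e : X -> X -> C).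
Variables (eta : X -> X -> X -> C) (eps : X -> X -> (X -> C) -> X -> C).
Variables (chi_ : forall x, G2 (U x)) (c : forall x, G3 (U x)).
Variables (gam g : forall x y, G3 (U x `&` U y)).
Hypothesis Ue : trivialization L U e.
Hypothesis chi_c : forall x, local_expression chi (e x) (chi_ x) /\ is_lift (c x) (chi_ x).
Hypothesis g_gam : forall x y, is_transition (transition e x y) (g x y) /\
  is_kernel_elt (eta x y) (eps x y) (gam x y).

Local Notation th := (theta c gam g).

(* [c z] composed with [exp (- t D_z)], where [D_z = D / e z], maps f to
   f + (lift_derivation z f) t^2. *)
Definition lift_derivation z (f : X -> C) (x : X) : C :=
  fun_coef (c z) 2 f x - 2%:R^-1 * fun_coef (c z) 1 (fun_coef (c z) 1 f) x
  - var_coef (c z) 2 x * fun_coef (c z) 1 f x.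

Lemma lift_derivationP z : is_der (U z) (lift_derivation z).
Proof.
have oU := (Ue.1 z).1.
have [vP _] := aut_reg (c z) 2 oU oU (@subset_refl _ _).
exact: hasse_der vP oU (endo_hasse (aut_endo (c z))).
Qed.

(** Multiplication by powers of [e x] turns the formulas of [conjugate_coefs] into identities
    between sections of L and of T_X (x) L^2, where e_y = nu e_x makes the last parenthesis a
    difference of one expression at x and at y. *)
Lemma theta_coefs x y :
  (forall p, U x p -> U y p ->
     var_coef (th x y) 1 p = 1 /\
     var_coef (th x y) 2 p * e x p = eta x y p * e x p
       + D (transition e x y) p / transition e x y p
       + (var_coef (c x) 2 p * e x p - var_coef (c y) 2 p * e y p)) /\
  (forall V f p, open V -> V `<=` U x `&` U y -> reg V f -> V p ->
     fun_coef (th x y) 1 f p = 0 /\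
     fun_coef (th x y) 2 f p * e x p ^+ 2 = eps x y f p * e x p ^+ 2
       - eta x y p * e x p * D f p
       - 2%:R^-1 * (D (transition e x y) p / transition e x y p * D f p)
       + (lift_derivation x f p * e x p ^+ 2 - lift_derivation y f p * e y p ^+ 2)).
Proof.
have [hU he] := Ue; have oU z := (hU z).1.
have lc z := lift_coefs (oU z) (he z) (chi_c z).1 (chi_c z).2.
pose nu := transition e x y; pose W := U x `&` U y.
have oW : open W by exact: openI.
have Wx : W `<=` U x by move=> ? [].
have Wy : W `<=` U y by move=> ? [].
have e0 z p : U z p -> e z p != 0 by exact: (he z).1.
have nu0 p : W p -> nu p != 0.
  by move=> [Up Uyp]; rewrite mulf_neq0 ?invr_neq0 ?e0.
have nuP : reg W nu by exact: frame_ratio.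
have eE p : W p -> e y p = nu p * e x p.
  by move=> [Up Uyp]; rewrite /nu /transition divfK // e0.
have [gf gv] := (transitionP nu (g x y) oW).1 (g_gam x y).1.
have [kf kv] := (kernel_eltP (eta x y) (eps x y) (gam x y) oW).1 (g_gam x y).2.
have cD V f p : open V -> V `<=` W -> reg V f -> V p ->
    fun_coef (c x) 1 f p = fun_coef (c y) 1 f p * nu p.
  move=> oV VW hf Vp; have Wp := VW p Vp.
  rewrite ((lc x).1 V) //; last exact: subset_trans Wx.
  rewrite ((lc y).1 V) //; last exact: subset_trans Wy.
  rewrite eE //; have := e0 x p (Wx p Wp); have := nu0 p Wp.
  by move=> n0 x0; field; rewrite ?n0 ?x0.
have cv p : W p -> var_coef (c x) 1 p = 1 /\ var_coef (c y) 1 p = 1.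
  by move=> Wp; split; [exact: (lc x).2 (Wx p Wp)|exact: (lc y).2 (Wy p Wp)].
have [thv thf] := conjugate_coefs oW (endo_res Wx (aut_endo (c x))) (aut_endo (gam x y))
  (aut_endo (g x y)) (endo_res Wy (aut_endo (c y))) (aut_endo (th x y))
  (fun V s oV VW hs p Vp => theta_comp c gam g oU oV VW hs Vp)
  gf gv kf kv cv cD nuP nu0.
have vE p : W p -> var_coef (th x y) 2 p * e x p = eta x y p * e x p + D nu p / nu p
    + (var_coef (c x) 2 p * e x p - var_coef (c y) 2 p * e y p).
  move=> Wp; have [_] := thv p Wp.
  rewrite ((lc x).1 W nu p oW Wx nuP Wp) eE //.
  have n0 := nu0 p Wp; have x0 := e0 x p (Wx p Wp) => h.
  by apply: (mulfI n0); rewrite [LHS]mulrA h; field; rewrite ?n0 ?x0.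
split=> [p Up Uyp|V f p oV VW hf Vp].
  by have [? _] := thv p (conj Up Uyp); split=> //; exact: vE.
have Wp := VW p Vp; have [-> e2] := thf V f p oV VW hf Vp; split=> //.
have n0 := nu0 p Wp; have x0 := e0 x p (Wx p Wp).
have VUx := subset_trans VW Wx; have VUy := subset_trans VW Wy.
have [d1 d2 d3 d4] := derivation_funP chi oV (@subsetT _ _).
have [_ cxP] := aut_reg (c x) 1 (oU x) oV VUx.
have [_ cyP] := aut_reg (c y) 1 (oU y) oV VUy.
have nuV : reg V nu by apply: reg_sub nuP.
have Axf := (lc x).1 V f p oV VUx hf Vp.
have Ayf := (lc y).1 V f p oV VUy hf Vp.
have Axx := (lc x).1 V _ p oV VUx (cxP f hf) Vp.
have Ayy := (lc y).1 V _ p oV VUy (cyP f hf) Vp.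
(* D_i^2 f is D (nu D_j f) / e_i; the Leibniz rule on this product is the source of the term in D
   nu. *)
have eA : {in V, fun_coef (c x) 1 f =1 nu \* fun_coef (c y) 1 f}.
  by move=> q; rewrite inE => Vq; rewrite (cD V) //= mulrC.
have pV : p \in V by rewrite inE.
rewrite (d2 _ _ (cxP f hf) (reg_mul oV nuV (cyP f hf)) eA p pV) in Axx.
rewrite (d4 _ _ nuV (cyP f hf) p Vp) in Axx.
have vp := vE p Wp.
rewrite /lift_derivation e2 Axx Ayy Axf.
rewrite Ayf in Axx *.
rewrite eE // in vp *.
(* Once eta' is eliminated, what remains is an identity of rational functions in independent
   values. *)
have -> : var_coef (th x y) 2 p = (eta x y p * e x p + D nu p / nu p +
   (var_coef (c x) 2 p * e x p - var_coef (c y) 2 p * (nu p * e x p))) / e x p.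
  by rewrite -vp mulfK.
rewrite -/nu.
move: (D (fun_coef (c y) 1 f) p) (D f p) (D nu p) (eps x y f p) (eta x y p).
move: (fun_coef (c x) 2 f p) (fun_coef (c y) 2 f p) (var_coef (c x) 2 p) (var_coef (c y) 2 p).
move: (nu p) (e x p) n0 x0 => n a n0 a0 *.
field.
by rewrite n0 a0.
Qed.

(** The cochains of theta differ from cocycles of the expected classes by the coboundaries of a_x
    e_x and of [lift_derivation x] times e_x^2, so [represents_cob] gives both the cocycle property
    and the class. *)
Lemma theta_represents gamma : gamma_represents U e eta eps gamma ->
  (forall x y, is_kernel_elt (var_coef (th x y) 2) (fun_coef (th x y) 2) (th x y)) /\
  gamma_represents U e (fun x y => var_coef (th x y) 2) (fun x y => fun_coef (th x y) 2)
    (gamma.1 + pairing (derivation_of chi) (nabla0 L),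
     gamma.2 - times gamma.1 (derivation_of chi)
     - (2%:R^-1 : C) *: times (pairing (derivation_of chi) (nabla0 L)) (derivation_of chi)).
Proof.
move=> [r1 r2]; have [hU he] := Ue; have oU z := (hU z).1.
have oUI x y : open (U x `&` U y) by exact: openI.
have hker x y : is_kernel_elt (var_coef (th x y) 2) (fun_coef (th x y) 2) (th x y).
  have [tv tf] := theta_coefs x y; apply/kernel_eltP => //.
  split=> [V f p oV VU hf Vp|p [Up Uyp]].
    by have [-> _] := tf V f p oV VU hf Vp.
  by have [-> _] := tv p Up Uyp.
split=> //.
(* Contracting d nu / nu with D gives D nu / nu, the term found in [theta_coefs]. *)
have rn := represents_map (contract_hom (derivation_of chi)) (represents_nabla0 Ue).
have rL := represents_lin 1 rn r1.
have rT := represents_lin (- 2%:R^-1 : C) (represents_map (times_hom (derivation_of chi)) rn)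
  (represents_lin (-1) (represents_map (times_hom (derivation_of chi)) r1) r2).
split.
- rewrite [X in represents _ _ X]/= addrC -[pairing _ _]scale1r.
  apply: represents_cob rL _ _ => [x y|].
    apply: (@lpow_ext _ _ L 1 _ (fun p => var_coef (th x y) 2 p * e x p ^+ 1)) => //.
    have [vP _] := aut_reg (th x y) 2 (oUI x y) (oUI x y) (@subset_refl _ _).
    exact: (frame_lpow 1 (oUI x y) (@subIsetl _ _ _) (he x) vP).
  exists (fun x p => var_coef (c x) 2 p * e x p); split=> [x|x y p [Up Uyp]].
    apply: (@lpow_ext _ _ L 1 _ (fun p => var_coef (c x) 2 p * e x p ^+ 1)) => //.
    have [vP _] := aut_reg (c x) 2 (oU x) (oU x) (@subset_refl _ _).
    exact: (frame_lpow 1 (oU x) (@subset_refl _ _) (he x) vP).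
  have [tv _] := theta_coefs x y; have [_ v2] := tv p Up Uyp.
  have -> : forall a b b' c d : X -> C^o, (a - (1 *: b + b') - (c - d)) p
    = a p - (1 * b p + b' p) - (c p - d p) by [].
  rewrite /L_cochain v2 /=.
  rewrite /contract /dlog /=.
  by ring.
- rewrite [X in represents _ _ X]/= -scaleNr addrC [gamma.2 - _]addrC -[- times _ _]scaleN1r.
  apply: represents_cob rT _ _ => [x y|].
    have hd : is_der (U x `&` U y) (fun_coef (th x y) 2).
      apply: hasse_der0 (endo_hasse (aut_endo (th x y))) _ => V f p oV VU hf Vp.
      by have [_ /(_ V f p oV VU hf Vp)[]] := theta_coefs x y.
    apply: frame_derivation hd => //.
    by apply: is_frame_sub (he x) => q [].
  exists (fun x f p => lift_derivation x f p * e x p ^+ 2); split=> [x|x y V f oV VU hf p Vp].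
    exact: (frame_derivation 2 (oU x) (he x) (@lift_derivationP x)).
  have [_ tf] := theta_coefs x y; have [_ v2] := tf V f p oV VU hf Vp.
  have -> : forall a b b' b'' c d : (X -> C) -> X -> C^o,
    (a - (- 2%:R^-1 *: b + (-1 *: b' + b'')) - (c - d)) f p
    = a f p - (- 2%:R^-1 * b f p + (-1 * b' f p + b'' f p)) - (c f p - d f p) by [].
  rewrite /TL2_cochain v2 /=.
  rewrite /contract /dlog /L_cochain /=.
  by ring.
Qed.

End Theta.

End Action.

(** * Uniqueness and existence of the value of the action *)

Section Orbits.
Variables (R : realType) (X : fspace R) (L : line_bundle X) (chi : Aut02 L).
Local Notation C := R[i].
Local Notation trunc n := {poly %/ ('X^n : {poly C})}.
Local Notation D := (derivation_fun chi).

Definition Aut02_translate gamma : H1 (Lpow L 1) * H1 (TLpow L 2) :=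
  (gamma.1 + pairing (derivation_of chi) (nabla0 L),
   gamma.2 - times gamma.1 (derivation_of chi)
   - (2%:R^-1 : C) *: times (pairing (derivation_of chi) (nabla0 L)) (derivation_of chi)).

(** Whatever [eta'] and [eps'] are chosen, [kernel_eltP] forces them to be the coefficients of theta
    over the intersections, whose classes are known. *)
Lemma action_rel_unique gamma gamma' :
  action_rel chi gamma gamma' -> gamma' = Aut02_translate gamma.
Proof.
move=> [U [e [eta [eps [eta' [eps' [chi_ [c [gam [g [Ue r hchi hg [hth r']]]]]]]]]]]].
have [_ [m1 m2]] := theta_represents Ue hchi hg r.
have hU := Ue.1; have oUI x y : open (U x `&` U y) by exact: openI (hU x).1 (hU y).1.
have hk x y := (kernel_eltP (eta' x y) (eps' x y) _ (oUI x y)).1 (hth x y).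
rewrite [LHS]surjective_pairing; congr pair.
- apply: (represents_eq r'.1 m1 hU); apply: coboundary_van => // x y p Wp.
  have [_ /(_ p Wp)[_ e2]] := hk x y.
  have -> : forall a b : X -> C^o, (a - b) p = a p - b p by [].
  by rewrite /L_cochain e2 subrr.
- apply: (represents_eq r'.2 m2 hU); apply: coboundary_van => // x y V f oV VU hf p Vp.
  have [/(_ V f p oV VU hf Vp)[_ e2] _] := hk x y.
  have -> : forall a b : (X -> C) -> X -> C^o, (a - b) f p = a f p - b f p by [].
  by rewrite /TL2_cochain e2 subrr.
Qed.

Lemma Ltrunc_var V l : open V -> lsec L V l ->
  Ltrunc L 1 V (fun y => l y *: tvar R 2).
Proof.
move=> oV hl [|[|k]].
- by apply: lpow_ext (lpow_cst0 L 0 oV) => // y _;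
    rewrite -[_`_0]/(tcoef 0 _) tcoefZ tcoef_var mulr0.
- apply: (lpow_ext (s := l)) => //; last exact/lpow1E.
  by move=> y _; rewrite -[_`_1]/(tcoef 1 _) tcoefZ tcoef_var mulr1.
- by apply: lpow_ext (lpow_cst0 L k.+2 oV) => // y _;
    rewrite -[_`_ _]/(tcoef k.+2 _) tcoefZ tcoef_var mulr0.
Qed.

(** By additivity and because it fixes L, chi maps f + l t to f + (D f + l) t; dividing the
    coefficient of t by e gives [jet2_map]. *)
Lemma local_expression_jet2 U e (phi : G2 U) : open U -> is_frame (lsec L) U e ->
  aut_fun phi = jet2_map (fun f x => D f x / e x) -> local_expression chi e phi.
Proof.
move=> oU he phiE V s oV VU hs x Vx; rewrite phiE.
have [_ _ p3 _ p5] := aut_endo (aut02_val chi) oV (@subsetT _ V).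
have e0 y : V y -> e y != 0 by move=> /VU; exact: he.1.
have h0 : reg V (coefs s 0) := hs 0; have h1 : reg V (coefs s 1) := hs 1.
have hl : lsec L V (fun y => coefs s 1 y * e y).
  apply/he.2 => //; apply: reg_ext h1 => y; rewrite inE => Vy.
  by rewrite mulfK // e0.
have P0 := Ltrunc_cst L oV h0; have P1 := Ltrunc_var oV hl.
have -> : trivialize e s = (fun y => 1 *: (coefs s 0 y)%:A + (coefs s 1 y * e y) *: tvar R 2).
  by apply/funext => y; rewrite scale1r.
rewrite p3 // scale1r (aut02P chi oV hl) ?inE //.
have [t0 t1] := tcoef_trivialize e (jet2_map (fun f x => D f x / e x) s) x.
apply: tcoef_eq => -[|[|k]] // _; rewrite tcoefD tcoefZ tcoef_var.
- rewrite t0 jet2_map0 mulr0 addr0.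
  rewrite (p5 _ P0 x Vx : tcoef 0 _ = tcoef 0 (tconst 2 _)).
  by rewrite tcoef_const mulr1.
- rewrite t1 jet2_map1 mulr1 mulrDl divfK ?e0 //.
Qed.

Lemma action_rel_exists gamma : exists gamma', action_rel chi gamma gamma'.
Proof.
have [U1 [s1 r1]] := represents_repr gamma.1.
have [U2 [s2 r2]] := represents_repr gamma.2.
have [hF hf] := frame_trivialization L.
(* The two classes come with unrelated coverings; frames and both cocycles are restricted to a
   common refinement. *)
pose U x := (U1 x `&` U2 x) `&` frame_dom L x; pose e := frame L.
have hU1 : covering U1 by case: r1.
have hU2 : covering U2 by case: r2.
have hU : covering U by apply: coveringI => //; exact: coveringI.
have oU x : open (U x) := (hU x).1.
have oUI x y : open (U x `&` U y) by exact: openI.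
have he x : is_frame (lsec L) (U x) (e x) by apply: is_frame_sub (hf x) => p [].
have Ue : trivialization L U e by [].
have e0 x p : U x p -> e x p != 0 by exact: (he x).1.
have {}r1 : represents U s1 gamma.1 by apply: represents_sub r1 => // x p [[]].
have {}r2 : represents U s2 gamma.2 by apply: represents_sub r2 => // x p [[]].
have hs1 : cocycle U s1 by case: r1 => ? [].
have hs2 : cocycle U s2 by case: r2 => ? [].
(* Off the domain of the frame this division loses the values of [s1], so the original cochain is
   recovered only up to [coboundary_van]. *)
pose eta x y : X -> C := fun p => s1 x y p / e x p.
pose eps x y : (X -> C) -> X -> C := fun f p => s2 x y f p / e x p ^+ 2.
have r : gamma_represents U e eta eps gamma.
  split.
  - apply: represents_cob r1 _ _ => [x y|].
      apply: lpow_ext (hs1.1 x y) => // p; rewrite inE => -[Up _].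
      by rewrite /L_cochain /eta divfK // e0.
    apply: coboundary_van => // x y p [Up _].
    have -> : forall a b : X -> C^o, (a - b) p = a p - b p by [].
    by rewrite /L_cochain /eta divfK ?e0 // subrr.
  - apply: represents_cob r2 _ _ => [x y|].
      apply: derivation_ext (hs2.1 x y) _ => V f p oV VU hf' Vp.
      by rewrite /TL2_cochain /eps divfK // expf_neq0 // e0 //; case: (VU p Vp).
    apply: coboundary_van => // x y V f oV VU hf' p Vp.
    have -> : forall a b : (X -> C) -> X -> C^o, (a - b) f p = a f p - b f p by [].
    rewrite /TL2_cochain /eps divfK ?subrr // expf_neq0 // e0 //; by case: (VU p Vp).
have heI x y : is_frame (lsec L) (U x `&` U y) (e x).
  by apply: is_frame_sub (he x) => p [].
have etaP x y : reg (U x `&` U y) (eta x y).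
  have := lpow_frame (oUI x y) (oUI x y) (hs1.1 x y) (heI x y).
  by rewrite setIid; apply: reg_ext => p _; rewrite expr1.
have epsP x y : is_der (U x `&` U y) (eps x y).
  exact: derivation_frame (oUI x y) (heI x y) (hs2.1 x y).
have AP x : is_der (U x) (fun f p => D f p / e x p).
  have DP : is_derivation L 1 (U x) D.
    by move=> V oV _; apply: (derivation_funP chi).
  exact: (derivation_frame (oU x) (he x) DP).
have hc x := cid (exp_exists (oU x) (AP x)).
pose c x := projT1 (hc x); pose chi_ x := projT1 (cid (projT2 (hc x))).
have hcP x : is_lift (c x) (chi_ x) /\ aut_fun (chi_ x) = jet2_map (fun f p => D f p / e x p).
  exact: projT2 (cid (projT2 (hc x))).
have nuP x y : reg (U x `&` U y) (transition e x y) by exact: frame_ratio.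
have nuVP x y : reg (U x `&` U y) (fun p => (transition e x y p)^-1).
  rewrite setIC; apply: reg_ext (nuP y x) => p _.
  by rewrite /transition invf_div.
have nu0 x y p : (U x `&` U y) p -> transition e x y p != 0.
  by move=> [Up Uyp]; rewrite mulf_neq0 ?invr_neq0 ?e0.
have hg x y := cid (transition_exists (oUI x y) (nuP x y) (nuVP x y) (@nu0 x y)).
have hk x y := cid (kernel_elt_exists (oUI x y) (etaP x y) (epsP x y)).
pose g x y := projT1 (hg x y); pose gam x y := projT1 (hk x y).
have hgk x y : is_transition (transition e x y) (g x y) /\
    is_kernel_elt (eta x y) (eps x y) (gam x y).
  by split; [exact: projT2 (hg x y)|exact: projT2 (hk x y)].
have hchi x : local_expression chi (e x) (chi_ x) /\ is_lift (c x) (chi_ x).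
  have [h1 h2] := hcP x; split=> //; exact: local_expression_jet2 (oU x) (he x) h2.
have [k1 k2] := theta_represents Ue hchi hgk r.
exists (Aut02_translate gamma), U, e, eta, eps, (fun x y => var_coef (theta c gam g x y) 2),
  (fun x y => fun_coef (theta c gam g x y) 2), chi_, c, gam, g.
by split.
Qed.

Lemma actionE gamma : action chi gamma = Aut02_translate gamma.
Proof.
have [gamma' h] := action_rel_exists gamma.
apply: action_rel_unique; rewrite /action.
(* The witness [h] excludes the default value of [xget]. *)
exact: xgetI h.
Qed.

End Orbits.

Theorem proposition6p5p2 (R : realType) (X : fspace R)
  (hX : smooth_connected_variety X) (L : line_bundle X)
  (eta eta' : H1 (Lpow L 1)) (epsilon epsilon' : H1 (TLpow L 2))
  (chi : Aut02 L) :
  (eta', epsilon') = action chi (eta, epsilon) ->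
  let D := derivation_of chi in
  eta' = eta + pairing D (nabla0 L) /\
  epsilon' = epsilon - times eta D
             - (2%:R^-1 : complex R) *: times (pairing D (nabla0 L)) D.
Proof. by rewrite actionE => -[-> ->]. Qed.
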